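(* Let $n\ge 1$ be an integer and put $T(n)=n^2-2n+2$. For every integer $N\ge T(n)$ there is a proper polynomial mapping $f:\mathbf{B}_n\to\mathbf{B}_N$ for which $N$ is the minimal imbedding dimension.
   Context: $\mathbf{B}_k$ denotes the open unit ball in $\mathbf{C}^k$. A proper polynomial mapping $f:\mathbf{B}_n\to\mathbf{B}_N$ is a mapping with holomorphic polynomial components in $z\in\mathbf{C}^n$ that maps $\mathbf{B}_n$ to $\mathbf{B}_N$ properly. Mappings $f,g:\mathbf{B}_n\to\mathbf{B}_N$ are spherically equivalent if $g=\psi\circ f\circ\phi$ for some holomorphic automorphisms $\phi$ of $\mathbf{B}_n$ and $\psi$ of $\mathbf{B}_N$. To say that $N$ is the minimal imbedding dimension (minimal target dimension) of $f:\mathbf{B}_n\to\mathbf{B}_N$ means that $f$ cannot be mapped into a lower-dimensional ball: no mapping spherically equivalent to $f$ has a component that vanishes identically, i.e. no mapping spherically equivalent to $f$ has image in $\mathbf{B}_N\cap(\mathbf{C}^{N'}\times\{0\})$ for some $N'<N$. *)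

(* Defs.v *)
From HB Require Import structures.
From mathcomp Require Import all_boot all_order all_algebra.
From mathcomp Require Import complex.
From mathcomp Require Import all_classical all_reals all_analysis.
From mathcomp Require mpoly.

Set Implicit Arguments.
Unset Strict Implicit.
Unset Printing Implicit Defensive.

Import Order.TTheory GRing.Theory Num.Theory.
Import numFieldNormedType.Exports.

Local Open Scope classical_set_scope.
Local Open Scope ring_scope.

(* Bundled as a numClosedFieldType: the library attaches its topology and its
   normed-module structure to the carrier of such a structure, not to the bare
   type R[i]. *)
Definition Complex (R : realType) : numClosedFieldType := R[i].

Section Balls.
Variable R : realType.
Local Notation C := (Complex R).

(* Euclidean unit ball of C^k.  The canonical norm on 'rV[C]_k is the sup norm,
   so it is not used here; it only provides the (usual) topology of C^k. *)
Definition unit_ball (k : nat) : set 'rV[C]_k :=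
  [set z | \sum_(i < k) `|z ord0 i| ^+ 2 < 1].

(* Mappings between balls are represented by total functions on C^n; in the
   definitions below only their values on the unit ball are relevant. *)

Definition polynomial_map n N (f : 'rV[C]_n -> 'rV[C]_N) : Prop :=
  exists p : 'I_N -> mpoly.mpoly n C,
    forall z j, f z ord0 j = mpoly.meval (fun i => z ord0 i) (p j).

Definition proper_ball_map n N (f : 'rV[C]_n -> 'rV[C]_N) : Prop :=
  set_fun (@unit_ball n) (@unit_ball N) f /\
  forall K : set 'rV[C]_N, K `<=` @unit_ball N -> compact K ->
    compact (@unit_ball n `&` f @^-1` K).

(* The scalar field of 'rV[C]_m as a normed module is C, so [differentiable]
   is complex (Frechet) differentiability. *)
Definition holomorphic_on m k (D : set 'rV[C]_m) (f : 'rV[C]_m -> 'rV[C]_k) :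
    Prop :=
  forall z, D z -> differentiable f z.

Definition ball_automorphism k (phi : 'rV[C]_k -> 'rV[C]_k) : Prop :=
  exists chi : 'rV[C]_k -> 'rV[C]_k,
    [/\ set_fun (@unit_ball k) (@unit_ball k) phi,
        set_fun (@unit_ball k) (@unit_ball k) chi,
        holomorphic_on (@unit_ball k) phi,
        holomorphic_on (@unit_ball k) chi &
        forall z, @unit_ball k z -> chi (phi z) = z /\ phi (chi z) = z].

Definition spherically_equivalent n N (f g : 'rV[C]_n -> 'rV[C]_N) : Prop :=
  exists phi psi, [/\ ball_automorphism phi, ball_automorphism psi &
    forall z, @unit_ball n z -> g z = psi (f (phi z))].

(* Since permuting the coordinates is an automorphism of the ball, it is
   immaterial which component of g vanishes. *)
Definition minimal_imbedding_dimension n N (f : 'rV[C]_n -> 'rV[C]_N) : Prop :=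
  forall g, spherically_equivalent f g ->
    ~ exists j : 'I_N, forall z, @unit_ball n z -> g z ord0 j = 0.

End Balls.

(* Integer-valued, since subtraction on nat is truncated. *)
Definition T (n : nat) : int := n%:Z ^+ 2 - 2 * n%:Z + 2.

(* Main.v *)
From mathcomp Require Import all_boot all_order all_algebra.
From mathcomp Require Import all_classical all_reals all_analysis.
From mathcomp Require Import ring lra zify complex.
From mathcomp Require mpoly.
Require Import Defs.

(* The map is a monomial one: starting from the identity, tensor [k] times on
   the current pure power of [z_0], keeping a part of that component on [j] of
   the occasions.  This reaches all dimensions [n + k (n - 1) + j] with
   [j <= k], hence all [N >= T n].  Its components and [1] are linearly
   independent, so no nontrivial affine function vanishes on its image.

   Minimality follows since an automorphism [psi] of the ball is a linear
   fractional map: the equation [psi_j = 0] is then a nontrivial affine one.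
   If [a] is the preimage of the origin, [psi] composed with the explicit
   involution exchanging [0] and [a] fixes the origin, and Schwarz's lemma
   (applied to it and to its inverse) makes it norm preserving; Cartan's
   argument, the maximum principle on complex lines through [0], makes it
   linear.  Holomorphy is here mere complex differentiability, so the maximum
   principle is derived from Goursat's bisection, applied to
   [(s, t) |-> k (exp (s + i t))] on rectangles of height [2 pi]: the mean of
   [k] on circles does not depend on the radius. *)

Set Implicit Arguments.
Unset Strict Implicit.
Unset Printing Implicit Defensive.

Import Order.TTheory GRing.Theory Num.Theory.
Import numFieldNormedType.Exports.
(* The notations of [mpoly] conflict with those of [all_analysis]. *)
Import (canonicals) mpoly.

Local Open Scope classical_set_scope.
Local Open Scope ring_scope.
Local Open Scope complex_scope.

(** * Goursat's theorem on a rectangle *)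

Section SegmentIntegral.
Variable R : realType.
Implicit Types (a b c : R) (f g : R -> R).

Definition seg_int a b f : R := \int[lebesgue_measure]_(x in `[a, b]) f x.

Definition seg_continuous a b f := forall x, a <= x <= b -> {for x, continuous f}.

Lemma seg_continuousS a b c d f :
  a <= c -> d <= b -> seg_continuous a b f -> seg_continuous c d f.
Proof.
by move=> ac db fc x /andP[cx xd]; apply: fc; rewrite (le_trans ac) ?(le_trans xd).
Qed.

Lemma seg_continuousB a b f g : seg_continuous a b f -> seg_continuous a b g ->
  seg_continuous a b (fun x => f x - g x).
Proof. by move=> fc gc x xab; apply: continuousB; [exact: fc | exact: gc]. Qed.

Lemma seg_continuous_integrable a b f : seg_continuous a b f ->
  (@lebesgue_measure R).-integrable `[a, b] (EFin \o f).
Proof.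
move=> fc; apply: continuous_compact_integrable; first exact: segment_compact.
by apply: continuous_in_subspaceT => x; rewrite inE/= in_itv/= => /fc.
Qed.

Lemma seg_intB a b f g : seg_continuous a b f -> seg_continuous a b g ->
  seg_int a b (fun x => f x - g x) = seg_int a b f - seg_int a b g.
Proof.
by move=> fc gc; rewrite /seg_int RintegralB//; exact: seg_continuous_integrable.
Qed.

Lemma seg_int_cst a b c : a <= b -> seg_int a b (fun=> c) = c * (b - a).
Proof.
move=> ab; rewrite /seg_int Rintegral_cst//=; rewrite (lebesgue_measure_itv `[a,b])/= lte_fin.
by case: ltgtP ab => //= -> _; rewrite subrr.
Qed.

Lemma seg_int_split m a b f : a <= m -> m <= b -> seg_continuous a b f ->
  seg_int a b f = seg_int a m f + seg_int m b f.
Proof.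
move=> am mb fc; apply/eqP; rewrite addrC -subr_eq /seg_int.
rewrite Rintegral_itvB ?bnd_simp//; last exact: seg_continuous_integrable.
rewrite Rintegral_itv_obnd_cbnd//; apply: integrableS (seg_continuous_integrable fc) => //.
by apply: subset_itv; rewrite bnd_simp.
Qed.

Lemma le_seg_int a b f g : seg_continuous a b f -> seg_continuous a b g ->
  (forall x, a <= x <= b -> f x <= g x) -> seg_int a b f <= seg_int a b g.
Proof.
by move=> fc gc fg; apply: le_Rintegral => //; exact: seg_continuous_integrable.
Qed.

Lemma seg_int_bound a b M f : a <= b -> seg_continuous a b f ->
  (forall x, a <= x <= b -> `|f x| <= M) -> `|seg_int a b f| <= M * (b - a).
Proof.
move=> ab fc fM.
have cc c : seg_continuous a b (fun=> c) by move=> x _; exact: cst_continuous.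
rewrite ler_norml -mulNr -!seg_int_cst//; apply/andP; split; apply: le_seg_int => // x /fM;
  by rewrite ler_norml => /andP[].
Qed.

(** If [f x] were positive, continuity would keep [f] above [f x / 2] on a whole interval to the
    left of [x], and the integral would be positive. This provides the equality case in
    [strong_max]. *)
Lemma seg_int_ge0_eq0 a b f x : seg_continuous a b f ->
  (forall y, a <= y <= b -> 0 <= f y) -> seg_int a b f <= 0 ->
  a < x < b -> f x = 0.
Proof.
move=> fc f0 intf /andP[ax xb].
have fx0' : 0 <= f x by apply: f0; rewrite !ltW.
apply/eqP; rewrite eq_le fx0' andbT leNgt.
apply/negP => fx0.
have fcx : {for x, continuous f} by apply: fc; rewrite !ltW.
have [d /= d0 fd] : exists2 d : R, 0 < d & forall y, `|x - y| < d -> f x / 2 <= f y.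
  have /cvgrPdist_le/(_ (f x / 2)) := fcx.
  rewrite divr_gt0// => /(_ isT)[d /= d0 fd]; exists d => // y /fd /=.
  rewrite ler_norml => /andP[_]; lra.
set p := Order.max a (x - d / 2).
have ap : a <= p by rewrite le_max lexx.
have px : p < x by rewrite gt_max ax/= ltrBlDr ltrDl divr_gt0.
have dp : x - d / 2 <= p by rewrite le_max lexx orbT.
have fpx : seg_int p x f >= f x / 2 * (x - p).
  rewrite -seg_int_cst; last exact: ltW.
  apply: le_seg_int.
  - by move=> ? _; exact: cst_continuous.
  - by apply: seg_continuousS fc => //; exact: ltW.
  by move=> y /andP[py yx]; apply: fd; rewrite ger0_norm; lra.
have cc : seg_continuous a b (fun=> 0) by move=> ? _; exact: cst_continuous.
have g0 c e : a <= c -> c <= e -> e <= b -> 0 <= seg_int c e f.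
  move=> ac ce eb; rewrite -[leLHS](mul0r (e - c)) -seg_int_cst//.
  apply: le_seg_int; [exact: seg_continuousS cc|exact: seg_continuousS fc|].
  by move=> y /andP[cy ye]; apply: f0; rewrite (le_trans ac)//= (le_trans ye).
move: intf; rewrite (@seg_int_split p)//; last by rewrite ltW// (lt_trans px).
rewrite (@seg_int_split x p)//; [|exact: ltW|exact: ltW|]; last first.
  by apply: seg_continuousS fc.
have := g0 a p (lexx _) ap (ltW (lt_trans px xb)).
have := g0 x b (ltW ax) (ltW xb) (lexx _).
have : 0 < f x / 2 * (x - p) by rewrite !mulr_gt0 ?subr_gt0.
lra.
Qed.

End SegmentIntegral.

Section Goursat.
Variable R : realType.
Implicit Types (u v : R -> R -> R) (a b c d s t : R).

(** Complex differentiability of [u + i v] at [s + i t] with derivative [al + i be]. Nothing is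
    asked about continuity of the derivative, hence the bisection argument below. *)
Definition cauchy_riemann u v s t := exists al be : R, forall e, 0 < e ->
  exists2 d, 0 < d & forall x y, `|x - s| <= d -> `|y - t| <= d ->
  `|u x y - u s t - (al * (x - s) - be * (y - t))| <= e * (`|x - s| + `|y - t|) /\
  `|v x y - v s t - (be * (x - s) + al * (y - t))| <= e * (`|x - s| + `|y - t|).

Lemma lipschitz_at_continuous (g : R -> R) x K d : 0 < d ->
  (forall y, `|y - x| <= d -> `|g y - g x| <= K * `|y - x|) ->
  {for x, continuous g}.
Proof.
move=> d0 gK; apply/cvgrPdist_le => e e0.
have K0 : 0 < `|K| + 1 by rewrite ltr_wpDl.
exists (Order.min d (e / (`|K| + 1))) => /=.
  by rewrite lt_min d0 divr_gt0.
move=> y /=; rewrite lt_min distrC => /andP[yd ye].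
rewrite distrC (le_trans (gK _ (ltW yd)))//.
move: ye; rewrite ltr_pdivlMr// mulrC => /ltW; apply: le_trans.
by rewrite ler_wpM2r// (le_trans (ler_norm _))// lerDl.
Qed.

Lemma cauchy_riemann_continuous u v s t : cauchy_riemann u v s t ->
  [/\ {for s, continuous (u^~ t)}, {for t, continuous (u s)},
      {for s, continuous (v^~ t)} & {for t, continuous (v s)}].
Proof.
move=> [al [be /(_ 1 ltr01)[d d0 H]]].
pose K := `|al| + `|be| + 1.
have tri (D L h A : R) : `|D - L| <= 1 * h -> `|L| <= A * h -> A <= K - 1 -> 0 <= h ->
    `|D| <= K * h.
  move=> h1 h2 h3 h4; rewrite -[D](subrK L) (le_trans (ler_normD _ _))//.
  rewrite (le_trans (lerD h1 h2))// -mulrDl ler_wpM2r//; lra.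
have na := normr_ge0 al; have nb := normr_ge0 be.
have z0 : `|0 : R| <= d by rewrite normr0 ltW.
split; apply: (@lipschitz_at_continuous _ _ K d) => // y yd.
- have /(_ _)[|+ _] := H y t yd; rewrite ?subrr// mulr0 subr0 normr0 addr0.
  by move=> /tri; apply; rewrite ?normrM//; rewrite /K; lra.
- have /(_ _)[|//|+ _] := H s y; rewrite ?subrr// mulr0 sub0r normr0 add0r.
  by move=> /tri; apply; rewrite ?normrN ?normrM//; rewrite /K; lra.
- have /(_ _)[|_ +] := H y t yd; rewrite ?subrr// mulr0 addr0 normr0 addr0.
  by move=> /tri; apply; rewrite ?normrM//; rewrite /K; lra.
- have /(_ _)[|//|_ +] := H s y; rewrite ?subrr// mulr0 add0r normr0 add0r.
  by move=> /tri; apply; rewrite ?normrM//; rewrite /K; lra.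
Qed.

(* The imaginary part of the integral of [(u + i v) d(s + i t)] along the
   boundary of [[a, b] x [c, d]], opposite sides being grouped. *)
Definition rect_int u v a b c d :=
  seg_int a b (fun x => v x c - v x d) + seg_int c d (fun y => u b y - u a y).

Definition rect_CR u v a b c d :=
  forall x y, a <= x <= b -> c <= y <= d -> cauchy_riemann u v x y.

(** The first-order part contributes [- al * h * w] through the horizontal sides and [al * w * h]
    through the vertical ones, so only remainders survive. Each difference of opposite sides
    involves two of them, hence the choice of [e / 2]. *)
Lemma rect_int_small u v s t e : cauchy_riemann u v s t -> 0 < e ->
  exists2 r, 0 < r & forall a b c d,
    a <= s <= b -> c <= t <= d -> b - a <= r -> d - c <= r ->
    rect_CR u v a b c d ->
    `|rect_int u v a b c d| <= e * ((b - a) + (d - c)) ^+ 2.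
Proof.
move=> [al [be H]] e0.
have [|r r0 {}H] := H (e / 2); first by rewrite divr_gt0.
exists r => // a b c d /andP[as_ sb] /andP[ct td] bar dcr CR.
set w := b - a; set h := d - c.
have cont x y : a <= x <= b -> c <= y <= d ->
  [/\ {for x, continuous (u^~ y)}, {for y, continuous (u x)},
      {for x, continuous (v^~ y)} & {for y, continuous (v x)}].
  by move=> xab ycd; apply: cauchy_riemann_continuous; exact: CR.
have dsx x : a <= x <= b -> `|x - s| <= w.
  by move=> /andP[ax xb]; rewrite ler_norml /w; apply/andP; split; lra.
have dty y : c <= y <= d -> `|y - t| <= h.
  by move=> /andP[ax xb]; rewrite ler_norml /h; apply/andP; split; lra.
have Hs x y : a <= x <= b -> c <= y <= d ->
    `|u x y - u s t - (al * (x - s) - be * (y - t))| <= e / 2 * (w + h) /\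
    `|v x y - v s t - (be * (x - s) + al * (y - t))| <= e / 2 * (w + h).
  move=> xab ycd; have [||h1 h2] := H x y.
  - by rewrite (le_trans (dsx _ xab)).
  - by rewrite (le_trans (dty _ ycd)).
  have k : e / 2 * (`|x - s| + `|y - t|) <= e / 2 * (w + h).
    by apply: ler_wpM2l; [lra | apply: lerD; [exact: dsx | exact: dty]].
  by split; [exact: le_trans h1 k | exact: le_trans h2 k].
have ab : a <= b by exact: le_trans sb.
have cd : c <= d by exact: le_trans td.
have aab : a <= a <= b by rewrite lexx.
have bab : a <= b <= b by rewrite lexx ab.
have ccd : c <= c <= d by rewrite lexx.
have dcd : c <= d <= d by rewrite lexx cd.
have csV : seg_continuous a b (fun x => v x c - v x d).
  by move=> x xab; apply: continuousB; [have [] := cont x c|have [] := cont x d].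
have csU : seg_continuous c d (fun y => u b y - u a y).
  by move=> y ycd; apply: continuousB; [have [] := cont b y|have [] := cont a y].
have cc p q (k : R) : seg_continuous p q (fun=> k) by move=> x _; exact: cst_continuous.
have bV : `|seg_int a b (fun x => v x c - v x d - (- al * h))| <= e * (w + h) * w.
  apply: seg_int_bound => //; first exact: seg_continuousB.
  move=> x xab; have [_ h1] := Hs x c xab ccd; have [_ h2] := Hs x d xab dcd.
  rewrite (_ : _ - _ = (v x c - v s t - (be * (x - s) + al * (c - t))) -
    (v x d - v s t - (be * (x - s) + al * (d - t)))); last by rewrite /h; ring.
  rewrite (le_trans (ler_normB _ _))// (le_trans (lerD h1 h2))//; lra.
have bU : `|seg_int c d (fun y => u b y - u a y - al * w)| <= e * (w + h) * h.
  apply: seg_int_bound => //; first exact: seg_continuousB.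
  move=> y ycd; have [h1 _] := Hs b y bab ycd; have [h2 _] := Hs a y aab ycd.
  rewrite (_ : _ - _ = (u b y - u s t - (al * (b - s) - be * (y - t))) -
    (u a y - u s t - (al * (a - s) - be * (y - t)))); last by rewrite /w; ring.
  rewrite (le_trans (ler_normB _ _))// (le_trans (lerD h1 h2))//; lra.
rewrite seg_intB// seg_int_cst// -/w in bV.
rewrite seg_intB// seg_int_cst// -/h in bU.
rewrite /rect_int.
move: bV bU; set X := seg_int _ _ _; set Y := seg_int _ _ _ => bV bU.
rewrite (_ : X + Y = (X - - al * h * w) + (Y - al * w * h)); last by ring.
rewrite (le_trans (ler_normD _ _))// (le_trans (lerD bV bU))//.
by rewrite -mulrDr -mulrA -expr2.
Qed.

(** The inner sides cancel, so the four quarters add up to the whole and cannot all stay below a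
    quarter of its size. *)
Lemma rect_int_quarter u v a c w h (k : R) : 0 <= w -> 0 <= h ->
  rect_CR u v a (a + w) c (c + h) ->
  k < `|rect_int u v a (a + w) c (c + h)| ->
  exists a' c', [/\ a <= a' <= a + w / 2, c <= c' <= c + h / 2 &
    k / 4 < `|rect_int u v a' (a' + w / 2) c' (c' + h / 2)|].
Proof.
move=> w0 h0 CR.
have cont x y : a <= x <= a + w -> c <= y <= c + h ->
  [/\ {for x, continuous (u^~ y)}, {for y, continuous (u x)},
      {for x, continuous (v^~ y)} & {for y, continuous (v x)}].
  by move=> xab ycd; apply: cauchy_riemann_continuous; exact: CR.
set m := a + w / 2; set n := c + h / 2; set b := a + w; set d := c + h.
have am : a <= m by rewrite /m; lra.
have mb : m <= b by rewrite /m /b; lra.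
have cn : c <= n by rewrite /n; lra.
have nd : n <= d by rewrite /n /d; lra.
have ab := le_trans am mb; have cd := le_trans cn nd.
have E : rect_int u v a b c d =
    rect_int u v a m c n + rect_int u v m b c n + rect_int u v a m n d + rect_int u v m b n d.
  rewrite /rect_int.
  have iV y p q : c <= y <= d -> a <= p -> q <= b -> seg_continuous p q (v^~ y).
    by move=> ? ap qb x /andP[px xq]; have [] := cont x y; rewrite ?(le_trans ap) ?(le_trans xq).
  have iU x p q : a <= x <= b -> c <= p -> q <= d -> seg_continuous p q (u x).
    by move=> ? ap qb y /andP[px xq]; have [] := cont x y; rewrite ?(le_trans ap) ?(le_trans xq).
  rewrite !seg_intB; try by [apply: iV; rewrite ?lexx ?cn ?nd ?cd ?am ?mb|apply: iU; rewrite ?lexx ?ab ?am ?mb].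
  have sV y : c <= y <= d -> seg_int a b (v^~ y) = seg_int a m (v^~ y) + seg_int m b (v^~ y).
    by move=> ycd; apply: seg_int_split => //; exact: iV.
  have sU x : a <= x <= b -> seg_int c d (u x) = seg_int c n (u x) + seg_int n d (u x).
    by move=> ycd; apply: seg_int_split => //; exact: iU.
  by rewrite !sV ?lexx ?cd// !sU ?lexx ?ab//; ring.
have mE : m + w / 2 = b by rewrite /m /b; lra.
have nE : n + h / 2 = d by rewrite /n /d; lra.
rewrite E => kl; apply: contrapT => /forallNP nex.
have nq a' c' : a <= a' <= m -> c <= c' <= n ->
    `|rect_int u v a' (a' + w / 2) c' (c' + h / 2)| <= k / 4.
  by move=> ha hc; rewrite leNgt; apply/negP => kl'; apply: (nex a'); exists c'.
have q1 : `|rect_int u v a m c n| <= k / 4 by apply: nq; rewrite lexx.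
have q2 : `|rect_int u v m b c n| <= k / 4 by rewrite -mE; apply: nq; rewrite lexx ?am.
have q3 : `|rect_int u v a m n d| <= k / 4 by rewrite -nE; apply: nq; rewrite lexx ?cn.
have q4 : `|rect_int u v m b n d| <= k / 4.
  by rewrite -nE -mE; apply: nq; rewrite lexx ?cn ?am.
move: kl; apply/negP; rewrite -leNgt.
have t1 := ler_normD (rect_int u v a m c n) (rect_int u v m b c n).
have t2 := ler_normD (rect_int u v a m c n + rect_int u v m b c n) (rect_int u v a m n d).
have t3 := ler_normD (rect_int u v a m c n + rect_int u v m b c n + rect_int u v a m n d)
  (rect_int u v m b n d).
lra.
Qed.

Theorem goursat u v a b c d : a <= b -> c <= d -> rect_CR u v a b c d ->
  rect_int u v a b c d = 0.
Proof.
move=> ab cd CR; apply/eqP; rewrite -normr_eq0 eq_le normr_ge0 andbT leNgt.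
apply/negP => J0.
set J := `|_| in J0.
set w := b - a; set h := d - c.
have w0 : 0 <= w by rewrite subr_ge0.
have h0 : 0 <= h by rewrite subr_ge0.
(* [p] is the lower left corner of the [n]-th rectangle. The bound starts from [J / 2] and not from
   [J] because [rect_int_quarter] works with strict inequalities. *)
pose corner (n : nat) (p : R * R) := [/\ a <= p.1 <= b - w / 2 ^+ n,
  c <= p.2 <= d - h / 2 ^+ n &
  J / 2 / 4 ^+ n < `|rect_int u v p.1 (p.1 + w / 2 ^+ n) p.2 (p.2 + h / 2 ^+ n)|].
pose next (n : nat) (p q : R * R) := p.1 <= q.1 <= p.1 + w / 2 ^+ n.+1 /\
  p.2 <= q.2 <= p.2 + h / 2 ^+ n.+1.
(* Placing [corner n p] under the existential makes the choice of [q] total in [p], so that the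
   sequence [P] can be defined by recursion. *)
have step n p : exists q, corner n p -> corner n.+1 q /\ next n p q.
  have [cp|ncp] := pselect (corner n p); last by exists p.
  have [/andP[ap pb] /andP[cp' pd] kJ] := cp.
  have wn0 : 0 <= w / 2 ^+ n by rewrite divr_ge0// exprn_ge0.
  have hn0 : 0 <= h / 2 ^+ n by rewrite divr_ge0// exprn_ge0.
  have [|a' [c' [/andP[aa ab'] /andP[cc cd'] kJ']]] := rect_int_quarter wn0 hn0 _ kJ.
    by move=> x y /andP[? ?] /andP[? ?]; apply: CR; apply/andP; split; lra.
  have w2 (k : R) : k / 2 ^+ n / 2 = k / 2 ^+ n.+1 by rewrite exprSr invfM mulrA.
  have e4 : J / 2 / 4 ^+ n / 4 = J / 2 / 4 ^+ n.+1 by rewrite [in RHS]exprSr invfM mulrA.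
  rewrite !w2 e4 in kJ' ab' cd'.
  have wE : w / 2 ^+ n = w / 2 ^+ n.+1 + w / 2 ^+ n.+1 by rewrite -w2; lra.
  have hE : h / 2 ^+ n = h / 2 ^+ n.+1 + h / 2 ^+ n.+1 by rewrite -w2; lra.
  exists (a', c') => _; split; last by split; rewrite /= ?aa ?cc.
  by split => //=; apply/andP; split; lra.
pose nx n p := projT1 (cid (step n p)).
pose P := fix P n := if n is m.+1 then nx m (P m) else (a, c).
have PC n : corner n (P n).
  elim: n => [|n IH].
    rewrite /corner /= !expr0 !divr1 /w /h !lexx; split; try by apply/andP; split; lra.
    by rewrite !addrA ![_ + b]addrC ![_ + d]addrC !addrK -/J; lra.
  by rewrite /P -/P /nx; case: cid => q /= /(_ IH)[].
have PN n : next n (P n) (P n.+1).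
  by rewrite {2}/P -/P /nx; case: cid => q /= /(_ (PC n))[].
have nd1 : {homo (fun n => (P n).1) : m n / (m <= n)%N >-> m <= n}.
  by apply/nondecreasing_seqP => n; have [/andP[]] := PN n.
have nd2 : {homo (fun n => (P n).2) : m n / (m <= n)%N >-> m <= n}.
  by apply/nondecreasing_seqP => n; have [_ /andP[]] := PN n.
have ni1 m n : (m <= n)%N -> (P n).1 + w / 2 ^+ n <= (P m).1 + w / 2 ^+ m.
  move=> /subnK <-; elim: (n - m)%N => // k; rewrite addSn; apply: le_trans.
  have [/andP[_ +] _] := PN (k + m)%N; have : w / 2 ^+ (k + m) = w / 2 ^+ (k + m).+1 * 2.
    by rewrite exprSr; field.
  lra.
have ni2 m n : (m <= n)%N -> (P n).2 + h / 2 ^+ n <= (P m).2 + h / 2 ^+ m.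
  move=> /subnK <-; elim: (n - m)%N => // k; rewrite addSn; apply: le_trans.
  have [_ /andP[_ +]] := PN (k + m)%N; have : h / 2 ^+ (k + m) = h / 2 ^+ (k + m).+1 * 2.
    by rewrite exprSr; field.
  lra.
have wn n : 0 <= w / 2 ^+ n by rewrite divr_ge0// exprn_ge0.
have hn n : 0 <= h / 2 ^+ n by rewrite divr_ge0// exprn_ge0.
(* [(s, t)] is the common point of the nested rectangles. *)
pose s := sup (range (fun n => (P n).1)); pose t := sup (range (fun n => (P n).2)).
have le_sup_seq (f : nat -> R) (l : nat -> R) :
    {homo f : m n / (m <= n)%N >-> m <= n} -> (forall n, 0 <= l n) ->
    (forall m n, (m <= n)%N -> f n + l n <= f m + l m) ->
    forall n, f n <= sup (range f) <= f n + l n.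
  move=> fnd l0 fni n.
  have ub k : f k <= f n + l n.
    have [kn|/ltnW nk] := leqP k n.
      by rewrite (le_trans (fnd _ _ kn))// lerDl.
    by rewrite (le_trans _ (fni _ _ nk))// lerDl.
  apply/andP; split.
    apply: ub_le_sup; last by exists n.
    by exists (f n + l n) => _ [k _ <-].
  by apply: ge_sup; [exists (f n), n|move=> _ [k _ <-]].
have Hs := le_sup_seq _ _ nd1 wn ni1.
have Ht := le_sup_seq _ _ nd2 hn ni2.
have CRst : cauchy_riemann u v s t.
  apply: CR.
    have /= := Hs 0%N; rewrite expr0 divr1 /w -/s; move=> /andP[-> ?] /=; lra.
  have /= := Ht 0%N; rewrite expr0 divr1 /h -/t; move=> /andP[-> ?] /=; lra.
have wh0 : 0 <= w + h by rewrite addr_ge0.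
(* With this [e], the local estimate on the [n]-th rectangle is at most [J / 2 / 4 ^+ n], against
   the third clause of [corner]. The [+ 1] covers a degenerate rectangle with [w + h = 0]. *)
pose e := J / 2 / ((w + h) ^+ 2 + 1).
have e0 : 0 < e by rewrite !divr_gt0// ltr_wpDl// sqr_ge0.
have [r r0 {}H] := rect_int_small CRst e0.
have [n nr] : exists n, (w + h) / 2 ^+ n <= r.
  exists (Num.bound ((w + h) / r)).
  rewrite ler_pdivrMr ?exprn_gt0// -ler_pdivrMl// mulrC ltW//.
  rewrite (lt_trans (archi_boundP _)) ?divr_ge0 ?(ltW r0)//.
  by rewrite -natrX ltr_nat ltn_expl.
have [h1 h2 h3] := PC n.
have wr : w / 2 ^+ n <= r.
  by rewrite (le_trans _ nr)// ler_wpM2r ?invr_ge0 ?exprn_ge0// lerDl.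
have hr : h / 2 ^+ n <= r.
  by rewrite (le_trans _ nr)// ler_wpM2r ?invr_ge0 ?exprn_ge0// lerDr.
have := H _ _ _ _ (Hs n) (Ht n).
rewrite ![_ + _ - _]addrC !addKr => /(_ wr hr)/(_ _)/wrap[].
  move=> x y /andP[? ?] /andP[? ?]; move: h1 h2 => /andP[? ?] /andP[? ?].
  by apply: CR; apply/andP; split; lra.
apply/negP; rewrite -ltNge; apply: le_lt_trans h3.
rewrite -mulrDl expr_div_n -exprM mulnC exprM (_ : 2 ^+ 2 = 4); last by ring.
rewrite mulrA ler_wpM2r ?invr_ge0 ?exprn_ge0//.
rewrite /e mulrAC ler_pdivrMr ?ltr_wpDl ?sqr_ge0//.
by rewrite ler_wpM2l ?divr_ge0 ?(ltW J0)// lerDl.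
Qed.

End Goursat.

(** * Complex numbers and complex derivatives *)

Section Modulus.
Variable R : realType.
Local Notation C := (Complex R).
Implicit Types (z w : C) (r : R).

Definition cre z : R := complex.Re z.
Definition cim z : R := complex.Im z.
(** The norm of [C] takes its values in [C]; a modulus with values in [R] gives access to the total
    order of [R]. *)
Definition cmod z : R := ComplexField.Normc.normc z.
Definition rc r : C := r%:C.
Definition ci : C := (0 +i* 1).

Lemma normE z : `|z| = rc (cmod z). Proof. by []. Qed.

Lemma rcD r s : rc (r + s) = rc r + rc s. Proof. exact: rmorphD. Qed.
Lemma rcN r : rc (- r) = - rc r. Proof. exact: rmorphN. Qed.
Lemma rcM r s : rc (r * s) = rc r * rc s. Proof. exact: rmorphM. Qed.
Lemma rc0 : rc 0 = 0. Proof. by []. Qed.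
Lemma rc1 : rc 1 = 1. Proof. by []. Qed.
Lemma rc_le r s : (rc r <= rc s) = (r <= s). Proof. exact: lecR. Qed.
Lemma rc_lt r s : (rc r < rc s) = (r < s). Proof. exact: ltcR. Qed.
Lemma rc_inj : injective rc. Proof. exact: complexI. Qed.
Lemma rcX r n : rc (r ^+ n) = rc r ^+ n. Proof. exact: rmorphXn. Qed.
Lemma rc_sum I (s : seq I) (P : pred I) (F : I -> R) :
  rc (\sum_(i <- s | P i) F i) = \sum_(i <- s | P i) rc (F i).
Proof. exact: rmorph_sum. Qed.

Lemma cE z : z = rc (cre z) + ci * rc (cim z).
Proof. exact: complexE. Qed.

Lemma creD z w : cre (z + w) = cre z + cre w. Proof. by case: z; case: w. Qed.
Lemma cimD z w : cim (z + w) = cim z + cim w. Proof. by case: z; case: w. Qed.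
Lemma creN z : cre (- z) = - cre z. Proof. by case: z. Qed.
Lemma cimN z : cim (- z) = - cim z. Proof. by case: z. Qed.
Lemma creM z w : cre (z * w) = cre z * cre w - cim z * cim w.
Proof. by case: z; case: w. Qed.
Lemma cimM z w : cim (z * w) = cre z * cim w + cim z * cre w.
Proof. by case: z => a b; case: w => c d. Qed.

Lemma c_eq z w : cre z = cre w -> cim z = cim w -> z = w.
Proof. by case: z => a b; case: w => c d /= -> ->. Qed.

Lemma cmodM z w : cmod (z * w) = cmod z * cmod w.
Proof. exact: ComplexField.Normc.normcM. Qed.
Lemma cmodV z : cmod z^-1 = (cmod z)^-1.
Proof. exact: ComplexField.Normc.normcV. Qed.
Lemma cmodD z w : cmod (z + w) <= cmod z + cmod w.
Proof. exact: le_normcD. Qed.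
Lemma cmodN z : cmod (- z) = cmod z.
Proof. exact: normcN. Qed.
Lemma cmodB z w : cmod (z - w) <= cmod z + cmod w.
Proof. by rewrite -(cmodN w) cmodD. Qed.
Lemma cmod0 : cmod 0 = 0. Proof. exact: ComplexField.Normc.normc0. Qed.
Lemma cmod1 : cmod 1 = 1. Proof. exact: ComplexField.Normc.normc1. Qed.
Lemma cmodX z n : cmod (z ^+ n) = cmod z ^+ n.
Proof. by elim: n => [|n IH]; rewrite ?expr0 ?cmod1// !exprS cmodM IH. Qed.
Lemma cmod_ge0 z : 0 <= cmod z. Proof. by case: z => a b; exact: sqrtr_ge0. Qed.
Lemma cmod_eq0 z : (cmod z == 0) = (z == 0).
Proof. by apply/eqP/eqP => [/ComplexField.Normc.eq0_normc|->]//; exact: cmod0. Qed.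
Lemma cmod_gt0 z : (0 < cmod z) = (z != 0).
Proof. by rewrite lt_def cmod_ge0 andbT cmod_eq0. Qed.
Lemma cmodBC z w : cmod (z - w) = cmod (w - z).
Proof. by rewrite -cmodN opprB. Qed.

Lemma cmod_sqr z : cmod z ^+ 2 = cre z ^+ 2 + cim z ^+ 2.
Proof. by case: z => a b; rewrite sqr_sqrtr// addr_ge0 ?sqr_ge0. Qed.

Lemma cre_le z : `|cre z| <= cmod z.
Proof.
rewrite -(@ler_pXn2r _ 2) ?nnegrE ?cmod_ge0// cmod_sqr real_normK ?num_real//.
by rewrite lerDl sqr_ge0.
Qed.

Lemma cim_le z : `|cim z| <= cmod z.
Proof.
rewrite -(@ler_pXn2r _ 2) ?nnegrE ?cmod_ge0// cmod_sqr real_normK ?num_real//.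
by rewrite lerDr sqr_ge0.
Qed.

Lemma cmod_rc r : cmod (rc r) = `|r|.
Proof. by rewrite /cmod /rc /= expr0n addr0 sqrtr_sqr. Qed.

Lemma cmod_le_re_im z : cmod z <= `|cre z| + `|cim z|.
Proof.
rewrite [z in leLHS]cE (le_trans (cmodD _ _))// cmodM !cmod_rc.
suff -> : cmod ci = 1 by rewrite mul1r.
by apply/eqP; rewrite -(@eqrXn2 _ 2) ?cmod_ge0// cmod_sqr /= expr0n add0r.
Qed.

Lemma cmod_le1_re1 z : cmod z <= 1 -> cre z = 1 -> z = 1.
Proof.
move=> z1 rz; have : cmod z ^+ 2 <= 1 by rewrite exprn_ile1 ?cmod_ge0.
rewrite cmod_sqr rz expr1n gerDl => iz.
by apply: c_eq => //; apply/eqP; rewrite -sqrf_eq0 eq_le iz sqr_ge0.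
Qed.

Lemma posC_rc z : 0 < z -> exists2 r, 0 < r & z = rc r.
Proof.
move=> z0; have : z \is Num.real by apply: gtr0_real.
by move/complex_realP => [k zk]; exists k => //; rewrite -rc_lt -[rc k]zk.
Qed.

End Modulus.

(** * Continuity and complex differentiability expressed with real moduli *)

Section ComplexDerivative.
Variable R : realType.
Local Notation C := (Complex R).

Lemma continuous_cmodP (k : C -> C) z : {for z, continuous k} <->
  forall e : R, 0 < e -> exists2 d : R, 0 < d &
    forall w, cmod (w - z) < d -> cmod (k w - k z) <= e.
Proof.
split=> [/cvgrPdist_le kc e e0|H].
  have := kc (rc e); rewrite -rc0 rc_lt => /(_ e0)[d' /= /posC_rc[d d0 ->] H].
  exists d => // w wz; rewrite -rc_le -normE distrC; apply: H => /=.
  by rewrite distrC normE rc_lt.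
apply/(@cvgrPdist_le _ _ _ (nbhs z)) => e' /posC_rc[e e0 ->]; have [d d0 {}H] := H e e0.
exists (rc d) => /=; first by rewrite -rc0 rc_lt.
move=> w /=; rewrite distrC normE rc_lt => /H.
by rewrite distrC normE rc_le.
Qed.

Lemma is_derive_small (K : numFieldType) (f : K -> K) (z c : K) :
  is_derive z (1 : K) f c -> forall e : K, 0 < e -> exists2 d : K, 0 < d &
    forall w : K, `|w - z| < d -> `|f w - f z - c * (w - z)| <= e * `|w - z|.
Proof.
move=> [fz fc] e e0.
have /cvgrPdist_le/(_ e e0)[d /= d0 H] :
    h^-1 *: ((f \o shift z) (h *: 1) - f z) @[h --> 0^'] --> c by rewrite -fc; exact: fz.
exists d => // w wz; have [->|wz'] := eqVneq w z.
  by rewrite !subrr mulr0 subr0 normr0 mulr0.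
have wz0 : w - z != 0 by rewrite subr_eq0.
have := H (w - z); rewrite /= sub0r normrN => /(_ wz wz0).
rewrite /GRing.scale/= mulr1 subrK => {}H.
by rewrite -ler_pdivrMr ?normr_gt0// -normf_div mulrBl mulfK// distrC mulrC.
Qed.

Lemma differentiable_cmod (k : C -> C) z : differentiable k z ->
  exists c : C, forall e : R, 0 < e -> exists2 d : R, 0 < d &
    forall w, cmod (w - z) < d -> cmod (k w - k z - c * (w - z)) <= e * cmod (w - z).
Proof.
move=> /derivable1_diffP/derivableP/is_derive_small H; exists ('D_1 k z) => e e0.
have [|d' /posC_rc[d d0 ->] {}H] := H (rc e); first by rewrite -rc0 rc_lt.
exists d => // w wz; rewrite -rc_le rcM -!normE; apply: H.
by rewrite normE rc_lt.
Qed.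

Lemma continuous_scale (c : C) (k : C -> C) z :
  {for z, continuous k} -> {for z, continuous (fun w => c * k w)}.
Proof.
move=> /continuous_cmodP kc; apply/continuous_cmodP => e e0.
have c0 : 0 < cmod c + 1 by rewrite ltr_wpDl ?cmod_ge0.
have [|d d0 H] := kc (e / (cmod c + 1)); first by rewrite divr_gt0.
exists d => // w /H; rewrite ler_pdivlMr// => h.
rewrite -mulrBr cmodM mulrC (le_trans _ h)// ler_wpM2l ?cmod_ge0// lerDl ler01//.
Qed.

Lemma differentiable_scale (c : C) (k : C -> C) z :
  differentiable k z -> differentiable (fun w => c * k w) z.
Proof. exact: differentiableZ. Qed.

Lemma differentiable_expr (k : C -> C) n z :
  differentiable k z -> differentiable (fun w => k w ^+ n) z.
Proof.
move=> kz; elim: n => [|n IH]; first exact: differentiable_cst.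
rewrite (_ : (fun _ => _) = (fun w => k w * k w ^+ n)); first exact: differentiableM.
by apply: funext => w; rewrite exprS.
Qed.

Lemma differentiable_continuousC (k : C -> C) z :
  differentiable k z -> {for z, continuous k}.
Proof. exact: differentiable_continuous. Qed.

Lemma differentiable_compC (k h : C -> C) z :
  differentiable h z -> differentiable k (h z) -> differentiable (k \o h) z.
Proof. exact: differentiable_comp. Qed.

Lemma continuous_compC (k h : C -> C) z :
  {for z, continuous h} -> {for h z, continuous k} -> {for z, continuous (k \o h)}.
Proof. exact: continuous_comp. Qed.

End ComplexDerivative.

(** * Mean value property and maximum principle *)

Section MeanValue.
Variable R : realType.
Local Notation C := (Complex R).

(** The exponential of [s + i t]: polar coordinates with logarithmic radius. The half plane [s < 0]
    covers the punctured unit disc. *)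
Definition cexp (s t : R) : C := rc (expR s) * (cos t +i* sin t).

Lemma cexpD s t x y : cexp (s + x) (t + y) = cexp s t * cexp x y.
Proof. by apply: c_eq; rewrite /cexp !(creM, cimM) /= expRD cosD sinD; ring. Qed.

Lemma cmod_cexp s t : cmod (cexp s t) = expR s.
Proof.
rewrite /cexp cmodM cmod_rc ger0_norm ?expR_ge0// (_ : cmod _ = 1) ?mulr1//.
by apply/eqP; rewrite -(@eqrXn2 _ 2) ?cmod_ge0// cmod_sqr expr1n cos2Dsin2.
Qed.

(** The exponential has derivative [1] at [0]; this is assembled from the real derivatives of
    [expR], [cos] and [sin]. *)
Lemma cexp_small (e : R) : 0 < e -> exists2 d : R, 0 < d &
  forall h l, `|h| < d -> `|l| < d ->
    cmod (cexp h l - 1 - (rc h + ci R * rc l)) <= e * (`|h| + `|l|).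
Proof.
move=> e0; set e' := Order.min 1 (e / 2).
have e'0 : 0 < e' by rewrite lt_min ltr01 divr_gt0.
have e'1 : e' <= 1 by rewrite ge_min lexx.
have e'e : e' <= e / 2 by rewrite ge_min lexx orbT.
have [d1 d10 H1] := is_derive_small (is_derive_expR 0) e'0.
have [d2 d20 H2] := is_derive_small (is_derive_cos 0) (divr_gt0 e'0 (ltr0n _ 2)).
have [d3 d30 H3] := is_derive_small (is_derive_sin 0) (divr_gt0 e'0 (ltr0n _ 2)).
pose d := Order.min (Order.min d1 d2) (Order.min d3 (e / 4)).
exists d => [|h l]; first by rewrite !lt_min d10 d20 d30 divr_gt0.
rewrite !lt_min => /andP[/andP[hd1 hd2] /andP[hd3 hd4]] /andP[/andP[ld1 ld2] /andP[ld3 ld4]].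
have {}H1 : `|expR h - 1 - h| <= e' * `|h|.
  by have := H1 h; rewrite expR0 !subr0 mul1r => /(_ hd1).
have {}H2 : `|cos l - 1| <= e' / 2 * `|l|.
  by have := H2 l; rewrite cos0 sin0 !subr0 oppr0 mul0r subr0 => /(_ ld2).
have {}H3 : `|sin l - l| <= e' / 2 * `|l|.
  by have := H3 l; rewrite cos0 sin0 !subr0 mul1r => /(_ ld3).
pose cis : C := cos l +i* sin l.
have cis1 : cmod cis = 1.
  by apply/eqP; rewrite -(@eqrXn2 _ 2) ?cmod_ge0// cmod_sqr expr1n cos2Dsin2.
have B2 : cmod (cis - 1 - ci R * rc l) <= e' * `|l|.
  rewrite (le_trans (cmod_le_re_im _))//.
  rewrite !(creD, creN, cimD, cimN, creM, cimM) /=.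
  rewrite (_ : _ - (_ - _) = cos l - 1); last by ring.
  rewrite (_ : sin l - _ - _ = sin l - l); last by ring.
  lra.
have cmodci : cmod (ci R) = 1.
  by apply/eqP; rewrite -(@eqrXn2 _ 2) ?cmod_ge0// cmod_sqr /= expr0n add0r.
have nh := normr_ge0 h; have nl := normr_ge0 l.
have B3 : cmod (cis - 1) <= 2 * `|l|.
  rewrite -[cis - 1](subrK (ci R * rc l)) (le_trans (cmodD _ _))//.
  rewrite cmodM cmodci cmod_rc mul1r.
  have : e' * `|l| <= 1 * `|l| by rewrite ler_wpM2r.
  lra.
(* The last summand is of second order: [cis - 1] is at most [2 * |l|], and [|h| < e / 4] absorbs
   the other factor. *)
rewrite (_ : _ - _ = rc (expR h - 1 - h) * cis + (cis - 1 - ci R * rc l) + rc h * (cis - 1));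
  last first.
  by rewrite /cexp -/cis !rcD !rcN rc1; ring.
have t1 := cmodD (rc (expR h - 1 - h) * cis + (cis - 1 - ci R * rc l)) (rc h * (cis - 1)).
have t2 := cmodD (rc (expR h - 1 - h) * cis) (cis - 1 - ci R * rc l).
rewrite cmodM cmod_rc cis1 mulr1 in t2.
rewrite (cmodM (rc h)) cmod_rc in t1.
have t3 : `|h| * cmod (cis - 1) <= e / 4 * (2 * `|l|).
  by rewrite ler_pM ?cmod_ge0// ltW.
have t4 : e' * `|h| <= e / 2 * `|h| by rewrite ler_wpM2r.
have t5 : e' * `|l| <= e / 2 * `|l| by rewrite ler_wpM2r.
have t6 : 0 <= e / 2 * `|h| by rewrite mulr_ge0// divr_ge0// ltW.
lra.
Qed.

(** Chain rule: if [c] is the derivative of [k] at [z0], that of [k] composed with the exponential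
    is [A = c * z0]. *)
Lemma polar_cauchy_riemann (k : C -> C) s t : differentiable k (cexp s t) ->
  cauchy_riemann (fun x y => cre (k (cexp x y))) (fun x y => cim (k (cexp x y))) s t.
Proof.
move=> /differentiable_cmod[c H]; set z0 := cexp s t in H *.
pose A := c * z0; exists (cre A), (cim A) => e e0.
set rho := expR s; have rho0 : 0 < rho := expR_gt0 s.
(* The displacement of [cexp] is at most [2 * rho * (|h| + |l|)], so the error of [k] costs [e / 2];
   [e2] makes the error of [cexp], multiplied by [A], cost another [e / 2]. *)
pose e1 := e / (4 * rho); have e10 : 0 < e1 by rewrite divr_gt0 ?mulr_gt0.
pose e2 := Order.min 1 (e / (2 * (cmod A + 1))).
have A1 : 0 < cmod A + 1 by rewrite ltr_wpDl ?cmod_ge0.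
have e20 : 0 < e2 by rewrite lt_min ltr01 divr_gt0 ?mulr_gt0.
have e21 : e2 <= 1 by rewrite ge_min lexx.
have e2A : cmod A * e2 <= e / 2.
  rewrite (@le_trans _ _ ((cmod A + 1) * (e / (2 * (cmod A + 1)))))//.
    by apply: ler_pM; rewrite ?cmod_ge0 ?(ltW e20) ?lerDl// ge_min lexx orbT.
  by rewrite le_eqVlt; apply/orP; left; apply/eqP; field; rewrite gt_eqF.
have [d1 d10 {}H] := H e1 e10; have [d2 d20 H2] := cexp_small e20.
pose d := Order.min (d1 / (8 * rho)) (d2 / 2).
exists d; first by rewrite lt_min !divr_gt0 ?mulr_gt0.
move=> x y; rewrite !le_min => /andP[xd1 xd2] /andP[yd1 yd2].
set h := x - s; set l := y - t; rewrite -/h -/l in xd1 xd2 yd1 yd2.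
have {}H2 : cmod (cexp h l - 1 - (rc h + ci R * rc l)) <= e2 * (`|h| + `|l|).
  by apply: H2; lra.
pose eta := rc h + ci R * rc l; pose err := cexp h l - 1 - eta.
have zE : cexp x y = z0 * cexp h l by rewrite -cexpD /h /l ![_ + (_ - _)]addrC !subrK.
have nh := normr_ge0 h; have nl := normr_ge0 l.
have etale : cmod eta <= `|h| + `|l|.
  rewrite (le_trans (cmod_le_re_im _))// /eta !(creD, cimD, creM, cimM) /=.
  by rewrite !mul0r !mul1r subr0 !addr0 !add0r.
have zz0 : cmod (cexp x y - z0) <= rho * (2 * (`|h| + `|l|)).
  rewrite zE -{2}[z0]mulr1 -mulrBr cmodM cmod_cexp -/rho ler_pM2l//.
  rewrite -[_ - 1](subrK eta) (le_trans (cmodD _ _))// (le_trans (lerD H2 etale))//.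
  have : e2 * (`|h| + `|l|) <= 1 * (`|h| + `|l|) by rewrite ler_wpM2r// addr_ge0.
  lra.
have zd : cmod (cexp x y - z0) < d1.
  rewrite (le_lt_trans zz0)//.
  have : rho * (2 * (`|h| + `|l|)) <= rho * (2 * (d1 / (8 * rho) + d1 / (8 * rho))).
    by rewrite ler_pM2l// ler_pM2l// lerD.
  rewrite (_ : rho * (2 * (_ + _)) = d1 / 2); last by field; rewrite gt_eqF.
  lra.
have {}H := H _ zd.
have main : cmod (k (cexp x y) - k z0 - A * eta) <= e * (`|h| + `|l|).
  rewrite (_ : _ - _ = (k (cexp x y) - k z0 - c * (cexp x y - z0)) + A * err); last first.
    by rewrite /A /err zE; ring.
  rewrite (le_trans (cmodD _ _))// cmodM.
  have h1 : cmod A * cmod err <= cmod A * (e2 * (`|h| + `|l|)) by rewrite ler_wpM2l ?cmod_ge0.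
  have h2 : cmod A * e2 * (`|h| + `|l|) <= e / 2 * (`|h| + `|l|) by rewrite ler_wpM2r// addr_ge0.
  have h3 : e1 * cmod (cexp x y - z0) <= e1 * (rho * (2 * (`|h| + `|l|))) by rewrite ler_pM2l.
  have h4 : e1 * (rho * (2 * (`|h| + `|l|))) = e / 2 * (`|h| + `|l|).
    by rewrite /e1; field; rewrite gt_eqF.
  lra.
split; apply: le_trans main.
  apply: le_trans (cre_le _); rewrite le_eqVlt; apply/orP; left; apply/eqP; congr `|_|.
  by rewrite /eta !(creD, creN, cimD, creM, cimM) /=; ring.
apply: le_trans (cim_le _); rewrite le_eqVlt; apply/orP; left; apply/eqP; congr `|_|.
by rewrite /eta !(creD, creN, cimN, cimD, creM, cimM) /=; ring.
Qed.

(* Periodicity in [t] makes the two horizontal sides of the rectangle cancel. *)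
Lemma circle_mean_constant (k : C -> C) a b :
  (forall z, 0 < cmod z < 1 -> differentiable k z) -> a <= b -> b < 0 ->
  seg_int 0 (pi *+ 2) (fun t => cre (k (cexp a t))) =
  seg_int 0 (pi *+ 2) (fun t => cre (k (cexp b t))).
Proof.
move=> kd ab b0.
have pi2 : 0 <= (pi : R) *+ 2 by rewrite mulrn_wge0 ?pi_ge0.
have CR : rect_CR (fun x y => cre (k (cexp x y))) (fun x y => cim (k (cexp x y)))
    a b 0 (pi *+ 2).
  move=> x y /andP[_ xb] _; apply/polar_cauchy_riemann/kd.
  by rewrite cmod_cexp expR_gt0 -expR0 ltr_expR (le_lt_trans xb).
have := goursat ab pi2 CR; rewrite /rect_int.
have per x : cexp x (pi *+ 2) = cexp x 0.
  by rewrite /cexp cos2pi sin2pi cos0 sin0.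
rewrite [X in seg_int a b X](_ : _ = fun=> 0); last first.
  by apply: funext => x; rewrite per subrr.
rewrite (seg_int_cst 0 ab) mul0r add0r seg_intB; last 2 first.
- by move=> y yd; have [] := cauchy_riemann_continuous (CR b y _ yd); rewrite ?ab ?lexx.
- by move=> y yd; have [] := cauchy_riemann_continuous (CR a y _ yd); rewrite ?ab ?lexx.
by move/subr0_eq => ->.
Qed.

Lemma circle_continuous (k : C -> C) b p q :
  (forall z, 0 < cmod z < 1 -> differentiable k z) -> b < 0 ->
  seg_continuous p q (fun t => cre (k (cexp b t))).
Proof.
move=> kd b0 y _.
have [] // := @cauchy_riemann_continuous _ (fun x y => cre (k (cexp x y)))
  (fun x y => cim (k (cexp x y))) b y.
by apply/polar_cauchy_riemann/kd; rewrite cmod_cexp expR_gt0 -expR0 ltr_expR.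
Qed.

(** The mean does not depend on the radius, so it may be computed on a circle so small that [k] is
    close to [k 0] there. At the centre only continuity is used. *)
Theorem mean_value (k : C -> C) b : {for 0, continuous k} ->
  (forall z, 0 < cmod z < 1 -> differentiable k z) -> b < 0 ->
  seg_int 0 (pi *+ 2) (fun t => cre (k (cexp b t))) = pi *+ 2 * cre (k 0).
Proof.
move=> k0 kd b0; apply/eqP; rewrite -subr_eq0 -normr_eq0 eq_le normr_ge0 andbT.
have pi2 : 0 < (pi : R) *+ 2 by rewrite mulrn_wgt0 ?pi_gt0.
rewrite -[leRHS](mulr0 (pi *+ 2)) -ler_pdivrMl//; apply/ler_addgt0Pr => e e0; rewrite add0r.
rewrite ler_pdivrMl//.
have /continuous_cmodP/(_ e e0)[d d0 H] := k0.
(* The circle of radius [expR a] lies strictly inside the disc of radius [d], and [a <= b] allows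
   the comparison of radii. *)
pose a := Order.min b (ln d - 1).
have ab : a <= b by rewrite ge_min lexx.
rewrite -(circle_mean_constant kd ab b0).
have := @seg_int_cst R 0 (pi *+ 2) (cre (k 0)) (ltW pi2).
rewrite subr0 mulrC => <-.
have a0 : a < 0 by exact: le_lt_trans b0.
have cc : seg_continuous 0 (pi *+ 2) (fun=> cre (k 0)) by move=> ? _; exact: cst_continuous.
rewrite -seg_intB//; last exact: circle_continuous.
rewrite mulrC -{2}[pi *+ 2]subr0; apply: seg_int_bound; first exact: ltW.
  by apply: seg_continuousB => //; exact: circle_continuous.
move=> t _; rewrite -creN -creD (le_trans (cre_le _))// H// subr0 cmod_cexp.
rewrite (@le_lt_trans _ _ (expR (ln d - 1)))//; first by rewrite ler_expR ge_min lexx orbT.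
by rewrite -[ltRHS]lnK ?posrE// ltr_expR gtrBl.
Qed.

(** A unimodular factor [u] turns [k 0] into its modulus; the real part of the mean value property
    then bounds it by [M]. *)
Lemma weak_max (k : C -> C) b M : {for 0, continuous k} ->
  (forall z, 0 < cmod z < 1 -> differentiable k z) -> b < 0 ->
  (forall t, cmod (k (cexp b t)) <= M) -> cmod (k 0) <= M.
Proof.
move=> k0 kd b0 kM.
have [->|kn0] := eqVneq (k 0) 0; first by rewrite cmod0 (le_trans (cmod_ge0 (k (cexp b 0)))).
pose u := rc (cmod (k 0)) / k 0.
have cu : cmod u = 1 by rewrite /u cmodM cmodV cmod_rc ger0_norm ?cmod_ge0// divff// cmod_eq0.
have pi2 : 0 < (pi : R) *+ 2 by rewrite mulrn_wgt0 ?pi_gt0.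
have ukd z : 0 < cmod z < 1 -> differentiable (fun z => u * k z) z.
  by move=> /kd; exact: differentiable_scale.
have uk0 : {for 0, continuous (fun z => u * k z)} by exact: continuous_scale.
have := mean_value uk0 ukd b0.
rewrite /u divfK//= => E.
rewrite -(ler_pM2l pi2) -[X in _ * X <= _]/(cre (rc (cmod (k 0)))) -E.
rewrite [leRHS](_ : _ = M * (pi *+ 2 - 0)); last by rewrite subr0 mulrC.
rewrite -(seg_int_cst _ (ltW pi2)); apply: le_seg_int.
- exact: (circle_continuous ukd).
- by move=> ? _; exact: cst_continuous.
move=> x _; rewrite (le_trans (ler_norm _))// (le_trans (cre_le _))//.
by rewrite -/u cmodM cu mul1r.
Qed.

(** On the circle through [z], the real part of [1 - k] is nonnegative with mean zero, hence
    vanishes; a number of modulus at most 1 with real part 1 equals 1. *)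
Lemma strong_max (k : C -> C) z : {for 0, continuous k} ->
  (forall w, 0 < cmod w < 1 -> differentiable k w) -> 0 < cmod z < 1 ->
  (forall w, cmod w = cmod z -> cmod (k w) <= 1) -> k 0 = 1 -> k z = 1.
Proof.
move=> k0 kd /andP[z0 z1] kM k01.
set b := ln (cmod z); have b0 : b < 0 by rewrite ln_lt0// z0.
have zb : expR b = cmod z by rewrite lnK.
pose c := - (z / rc (cmod z)).
have rz0 : rc (cmod z) != 0 by rewrite -cmod_gt0 cmod_rc ger0_norm ?cmod_ge0.
have c1 : cmod c = 1.
  by rewrite /c cmodN cmodM cmodV cmod_rc ger0_norm ?cmod_ge0// divff// gt_eqF.
(* The rotation by [c] brings [z] to the midpoint of the parameter interval. *)
have zE : z = c * cexp b pi.
  rewrite /cexp zb cospi sinpi (_ : (-1 +i* 0) = - rc 1 :> C); last by rewrite -rcN.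
  by rewrite /c rc1 mulrN mulr1 mulrNN divfK.
pose h w := k (c * w).
have cd w : differentiable (fun w => c * w) w by exact: differentiable_scale.
have hd w : 0 < cmod w < 1 -> differentiable h w.
  by move=> w01; apply: (differentiable_compC (cd w)); apply: kd; rewrite cmodM c1 mul1r.
have h0 : {for 0, continuous h}.
  by apply: (continuous_compC (differentiable_continuousC (cd 0))); rewrite mulr0.
have hM t : cmod (h (cexp b t)) <= 1.
  by apply: kM; rewrite cmodM c1 mul1r cmod_cexp.
have pi2 : 0 < (pi : R) *+ 2 by rewrite mulrn_wgt0 ?pi_gt0.
have cc : seg_continuous 0 (pi *+ 2) (fun=> (1 : R)) by move=> ? _; exact: cst_continuous.
rewrite zE; apply: (@cmod_le1_re1 _ (h (cexp b pi))) => //.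
apply/esym/eqP; rewrite -subr_eq0; apply/eqP.
apply: (@seg_int_ge0_eq0 R 0 (pi *+ 2) (fun t => 1 - cre (h (cexp b t)))).
- by apply: seg_continuousB => //; exact: circle_continuous.
- move=> y _; rewrite subr_ge0 (le_trans (ler_norm _))// (le_trans (cre_le _))//.
- rewrite seg_intB//; last exact: circle_continuous.
  by rewrite mean_value// /h mulr0 k01 (seg_int_cst _ (ltW pi2)) subr0 /= mulr1 mul1r subrr.
- by rewrite pi_gt0 mulr2n ltrDl pi_gt0.
Qed.

End MeanValue.

(** * Schwarz's lemma in the disc *)

Section SchwarzDisc.
Variable R : realType.
Local Notation C := (Complex R).

Definition cconj (z : C) : C := (complex.Re z) -i* (complex.Im z).

Lemma creJ z : cre (cconj z) = cre z. Proof. by []. Qed.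
Lemma cimJ z : cim (cconj z) = - cim z. Proof. by []. Qed.
Lemma cmodJ z : cmod (cconj z) = cmod z.
Proof.
by apply/eqP; rewrite -(@eqrXn2 _ 2) ?cmod_ge0// !cmod_sqr creJ cimJ sqrrN.
Qed.

(** For [a] in the unit disc, the disc automorphism carrying [0] to [a]. *)
Definition disc_moebius (a z : C) : C := (z + a) / (1 + cconj a * z).

Lemma disc_moebius_id (a z : C) : cmod (1 + cconj a * z) ^+ 2 - cmod (z + a) ^+ 2 =
  (1 - cmod z ^+ 2) * (1 - cmod a ^+ 2).
Proof. by rewrite !cmod_sqr !(creD, cimD, creM, cimM, creJ, cimJ) /=; ring. Qed.

Lemma disc_moebius_den (a z : C) : cmod a < 1 -> cmod z < 1 ->
  1 - cmod a <= cmod (1 + cconj a * z).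
Proof.
move=> a1 z1; have := cmodB (1 + cconj a * z) (cconj a * z).
rewrite addrK cmod1 cmodM cmodJ.
have : cmod a * cmod z <= cmod a * 1 by rewrite ler_wpM2l ?cmod_ge0// ltW.
lra.
Qed.

(** The lower bound says quantitatively that circles close to the unit circle are mapped close to
    it. It comes from [disc_moebius_id], and from the fact that a modulus below 1 dominates its
    square. *)
Lemma disc_moebius_lower (a z : C) : cmod a < 1 -> cmod z < 1 ->
  cmod (disc_moebius a z) < 1 /\
  1 - (1 - cmod z ^+ 2) / (1 - cmod a) ^+ 2 <= cmod (disc_moebius a z).
Proof.
move=> a1 z1; have den := disc_moebius_den a1 z1.
set D := cmod (1 + _) in den.
have pa : 0 < 1 - cmod a by lra.
have D0 : 0 < D by lra.
have m2 : cmod (disc_moebius a z) ^+ 2 = 1 - (1 - cmod z ^+ 2) * (1 - cmod a ^+ 2) / D ^+ 2.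
  rewrite -disc_moebius_id /disc_moebius cmodM cmodV -/D expr_div_n.
  by field; rewrite gt_eqF.
have z2 : 0 < 1 - cmod z ^+ 2 by rewrite subr_gt0 exprn_ilt1 ?cmod_ge0.
have a2 : 0 < 1 - cmod a ^+ 2 by rewrite subr_gt0 exprn_ilt1 ?cmod_ge0.
have lt1 : cmod (disc_moebius a z) < 1.
  rewrite -(@ltr_pXn2r _ 2) ?nnegrE ?cmod_ge0// expr1n m2 gtrBl.
  by rewrite divr_gt0 ?mulr_gt0 ?exprn_gt0.
split=> //; rewrite (@le_trans _ _ (cmod (disc_moebius a z) ^+ 2))//; last first.
  by rewrite expr2 ler_piMl ?cmod_ge0// ltW.
rewrite m2 lerD2l lerN2 -mulrA ler_pM2l//.
rewrite (@le_trans _ _ ((D ^+ 2)^-1))//.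
  by rewrite ler_piMl ?invr_ge0 ?sqr_ge0// gerBl sqr_ge0.
by rewrite lef_pV2 ?posrE ?exprn_gt0// ler_pXn2r ?nnegrE// ltW.
Qed.

Lemma disc_moebius_differentiable (a z : C) : cmod a < 1 -> cmod z < 1 ->
  differentiable (disc_moebius a) z.
Proof.
move=> a1 z1; have den := disc_moebius_den a1 z1.
apply: differentiableM; first by apply: differentiableD.
apply: differentiableV; first by apply: differentiableD => //; exact: differentiableZ.
by rewrite -cmod_gt0 (lt_le_trans _ den)// subr_gt0.
Qed.

(* A removable singularity that needs no theory: the difference quotient at [0]
   is [(g w / w) ^+ n.+2], which converges. *)
Lemma differentiable_quotient0 (g : C -> C) n : differentiable g 0 -> g 0 = 0 ->
  differentiable (fun w => g w ^+ n.+2 / w ^+ n.+1) 0.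
Proof.
move=> /derivable1_diffP gd g0; apply/derivable1_diffP; rewrite /derivable.
have gc : h^-1 *: ((g \o shift 0) (h *: 1) - g 0) @[h --> (0 : C)^'] --> 'D_1 g 0 by exact: gd.
apply/cvg_ex; exists ('D_1 g 0 ^+ n.+2).
pose q (h : C) : C := h^-1 *: ((g \o shift 0) (h *: 1) - g 0).
have qX m : (fun h => q h ^+ m) @ (0 : C)^' --> 'D_1 g 0 ^+ m.
  elim: m => [|m IH].
    by rewrite expr0 (_ : (fun _ => _) = cst 1); [exact: cvg_cst|apply: funext => h; rewrite expr0].
  rewrite exprS (_ : (fun _ => _) = (fun h => q h * q h ^+ m)); last first.
    by apply: funext => h; rewrite exprS.
  exact: (cvgM gc IH).
apply: cvg_trans (qX n.+2).
apply: near_eq_cvg.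
have : \forall h \near (0 : C)^', h != 0 by exact: nbhs_dnbhs_neq.
apply: filterS => h h0.
rewrite /q /= /shift/= g0 addr0 /GRing.scale/= mulr1 expr0n/= mul0r !subr0.
rewrite exprMn exprVn [in RHS]mulrC -mulrA -invfM -exprSr mulrC.
by [].
Qed.

(** Maximum principle for [g w ^+ n.+2 / w ^+ n.+1]. Since [weak_max] bounds the value at the centre
    only, [disc_moebius a] first moves the centre to [a]; a large circle is then mapped to points of
    modulus at least [th]. *)
Lemma schwarz_power (g : C -> C) n (th : R) a :
  (forall z, cmod z < 1 -> differentiable g z) ->
  (forall z, cmod z < 1 -> cmod (g z) <= 1) -> g 0 = 0 -> 0 < cmod a < 1 -> 0 < th < 1 ->
  cmod (g a) ^+ n.+2 / cmod a ^+ n.+1 <= th^-1 ^+ n.+1.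
Proof.
move=> gd g1 g0 /andP[a0 a1] /andP[th0 th1].
pose k w := g w ^+ n.+2 / w ^+ n.+1.
have kd z : cmod z < 1 -> differentiable k z.
  have [->|z0] := eqVneq z 0; first by move=> z1; apply: differentiable_quotient0 => //; exact: gd.
  move=> z1; apply: differentiableM; first by apply: differentiable_expr; exact: gd.
  by apply: differentiableV; [exact: differentiable_expr|rewrite expf_neq0].
pose K := k \o disc_moebius a.
have m0 : disc_moebius a 0 = a by rewrite /disc_moebius add0r mulr0 addr0 divr1.
have Kd z : cmod z < 1 -> differentiable K z.
  move=> z1; apply: differentiable_compC; first exact: disc_moebius_differentiable.
  by apply: kd; have [] := disc_moebius_lower a1 z1.
pose B := (1 - cmod a) ^- 2.
have B0 : 0 < B by rewrite invr_gt0 exprn_gt0// subr_gt0.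
(* Chosen so that [1 - r ^+ 2 <= 2 * (1 - r) <= (1 - th) / B], which yields modulus at least [th] by
   [disc_moebius_lower]; [1/2] keeps [r] positive, so that [ln r] is its logarithm. *)
pose r := Order.max (1/2) (1 - (1 - th) / (2 * B)).
have r0 : 0 < r by rewrite lt_max divr_gt0.
have r1 : r < 1.
  rewrite gt_max; apply/andP; split; first lra.
  by rewrite gtrBl divr_gt0 ?mulr_gt0 ?subr_gt0.
have rB : (1 - r ^+ 2) * B <= 1 - th.
  have h1 : 1 - r <= (1 - th) / (2 * B).
    by rewrite lerBlDr -lerBlDl le_max lexx orbT.
  have h2 : 1 - r ^+ 2 <= 2 * (1 - r).
    by rewrite -subr_ge0 (_ : _ - _ = (1 - r) ^+ 2) ?sqr_ge0//; ring.
  rewrite -ler_pdivlMr// (le_trans h2)// mulrC -ler_pdivlMr// (le_trans h1)//.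
  by rewrite invfM mulrA mulrAC.
have b0 : ln r < 0 by rewrite ln_lt0// r0.
have cK0 : {for 0, continuous K} by apply: differentiable_continuousC; apply: Kd; rewrite cmod0.
have := @weak_max R K (ln r) (th^-1 ^+ n.+1) cK0 _ b0.
have -> : K 0 = k a by rewrite /K /comp m0.
rewrite /k cmodM cmodV !cmodX; apply.
  by move=> z /andP[_ z1]; exact: Kd.
move=> t; have z1 : cmod (cexp (ln r) t) < 1 by rewrite cmod_cexp lnK.
set z := cexp _ _ in z1 *.
have [m1 mlow] := disc_moebius_lower a1 z1.
rewrite /K /= /k cmodM cmodV !cmodX.
set m := disc_moebius a z in m1 mlow *.
have thm : th <= cmod m.
  rewrite (le_trans _ mlow)//.
  have -> : cmod z = r by rewrite cmod_cexp lnK.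
  move: rB; rewrite /B; lra.
have m0' : 0 < cmod m by exact: lt_le_trans thm.
rewrite -[leRHS]mul1r; apply: ler_pM; rewrite ?exprn_ge0 ?cmod_ge0 ?invr_ge0//.
- by rewrite exprn_ge0// cmod_ge0.
- by rewrite exprn_ile1 ?cmod_ge0// g1.
- by rewrite exprVn lef_pV2 ?posrE ?exprn_gt0// ler_pXn2r ?nnegrE// ltW.
Qed.

(** If [x], the modulus of [g z], exceeded that of [z], some [th < 1] would give [y < 1], and
    [schwarz_power] reads [x <= y ^+ n.+1] for all [n], the surplus power of [g] leaving one factor
    [x]. Letting [n] grow contradicts [0 < x]. *)
Theorem schwarz (g : C -> C) z :
  (forall z, cmod z < 1 -> differentiable g z) ->
  (forall z, cmod z < 1 -> cmod (g z) <= 1) -> g 0 = 0 -> cmod z < 1 ->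
  cmod (g z) <= cmod z.
Proof.
move=> gd g1 g0 z1; have [->|z0] := eqVneq z 0; first by rewrite g0.
rewrite leNgt; apply/negP => zg.
rewrite -cmod_gt0 in z0.
set x := cmod (g z) in zg; have x1 : x <= 1 by exact: g1.
have x0 : 0 < x by exact: lt_trans zg.
have zx1 : cmod z / x < 1 by rewrite ltr_pdivrMr// mul1r.
have zx0 : 0 < cmod z / x by rewrite divr_gt0.
have [th th01 thz] : exists2 th : R, 0 < th < 1 & cmod z / x < th.
  by exists ((1 + cmod z / x) / 2); [apply/andP; split|]; lra.
have /andP[th0 th1] := th01.
pose y := cmod z / x / th.
have y0 : 0 < y by rewrite divr_gt0.
have y1 : `|y| < 1 by rewrite gtr0_norm// ltr_pdivrMr// mul1r.
have key n : x <= y ^+ n.+1.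
  have z01 : 0 < cmod z < 1 by rewrite z0.
  have := schwarz_power n gd g1 g0 z01 th01.
  rewrite -/x exprS ler_pdivrMr ?exprn_gt0//.
  rewrite -ler_pdivlMr ?exprn_gt0// => /le_trans; apply.
  by rewrite /y !expr_div_n exprVn [leRHS]mulrC [leRHS]mulrA.
have /cvgrPdist_lt/(_ x x0)[n _ /(_ n.+1)] := cvg_expr y1.
rewrite /= sub0r normrN => /(_ (leqnSn n)); rewrite gtr0_norm ?exprn_gt0//.
by rewrite ltNge key.
Qed.

End SchwarzDisc.

(** * Hermitian geometry of the ball *)

Section Hermitian.
Variables (R : realType) (k : nat).
Local Notation C := (Complex R).
Implicit Types (u v w z : 'rV[C]_k) (c : C).

Definition hdot v w : C := \sum_i v ord0 i * cconj (w ord0 i).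
Definition sqn v : R := \sum_i cmod (v ord0 i) ^+ 2.

Lemma unit_ballE v : unit_ball v = (sqn v < 1) :> Prop.
Proof.
rewrite /unit_ball /= -[1 in X in is_true X]/(rc 1) /sqn -rc_lt rc_sum.
by under [in RHS]eq_bigr do rewrite rcX -normE.
Qed.

Lemma cconjD (a b : C) : cconj (a + b) = cconj a + cconj b.
Proof. by apply: c_eq; rewrite ?(creD, cimD, creJ, cimJ)// opprD. Qed.
Lemma cconjM (a b : C) : cconj (a * b) = cconj a * cconj b.
Proof. by apply: c_eq; rewrite ?(creM, cimM, creJ, cimJ)//; ring. Qed.
Lemma cconjK (a : C) : cconj (cconj a) = a.
Proof. by apply: c_eq; rewrite ?(creJ, cimJ)// opprK. Qed.
Lemma cconj0 : cconj 0 = 0 :> C.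
Proof. by apply: c_eq; rewrite ?(creJ, cimJ)// oppr0. Qed.
Lemma cconj_rc (r : R) : cconj (rc r) = rc r.
Proof. by apply: c_eq; rewrite ?(creJ, cimJ)// oppr0. Qed.
Lemma mulcJ (a : C) : a * cconj a = rc (cmod a ^+ 2).
Proof.
by apply: c_eq; rewrite ?(creM, cimM, creJ, cimJ) ?cmod_sqr /=; ring.
Qed.
Lemma cconj_sum I (s : seq I) (F : I -> C) :
  cconj (\sum_(i <- s) F i) = \sum_(i <- s) cconj (F i).
Proof. by elim/big_rec2: _ => [|i x y _ <-]; rewrite ?cconj0 ?cconjD. Qed.

Lemma hdotDl u v w : hdot (u + v) w = hdot u w + hdot v w.
Proof. by rewrite -big_split; apply: eq_bigr => i _; rewrite mxE mulrDl. Qed.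
Lemma hdotZl c v w : hdot (c *: v) w = c * hdot v w.
Proof. by rewrite mulr_sumr; apply: eq_bigr => i _; rewrite mxE mulrA. Qed.
Lemma hdotJ v w : hdot w v = cconj (hdot v w).
Proof.
by rewrite cconj_sum; apply: eq_bigr => i _; rewrite cconjM cconjK mulrC.
Qed.
Lemma hdotZr c v w : hdot v (c *: w) = cconj c * hdot v w.
Proof. by rewrite hdotJ hdotZl cconjM -hdotJ. Qed.
Lemma hdot_sqn v : hdot v v = rc (sqn v).
Proof. by rewrite rc_sum; apply: eq_bigr => i _; rewrite mulcJ. Qed.
Lemma hdot0l w : hdot 0 w = 0.
Proof. by rewrite -(scale0r (0 : 'rV_k)) hdotZl mul0r. Qed.

Lemma sqn_ge0 v : 0 <= sqn v.
Proof. by apply: sumr_ge0 => i _; rewrite sqr_ge0. Qed.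
Lemma sqn0 : sqn 0 = 0.
Proof. by apply: big1 => i _; rewrite mxE cmod0 expr0n. Qed.
Lemma sqn_eq0 v : sqn v = 0 -> v = 0.
Proof.
move/psumr_eq0P => H; apply/rowP => i; rewrite mxE; apply/eqP.
by rewrite -cmod_eq0 -sqrf_eq0 H// => j _; rewrite sqr_ge0.
Qed.
Lemma sqnZ c v : sqn (c *: v) = cmod c ^+ 2 * sqn v.
Proof. by rewrite mulr_sumr; apply: eq_bigr => i _; rewrite mxE cmodM exprMn. Qed.
Lemma sqnD v w : sqn (v + w) = sqn v + 2 * cre (hdot v w) + sqn w.
Proof.
apply: (@rc_inj R); rewrite -hdot_sqn hdotDl (hdotJ (v + w) v) (hdotJ (v + w) w).
rewrite !hdotDl !hdot_sqn (hdotJ v w) !cconjD cconjK !cconj_rc.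
by apply: c_eq; rewrite !(creD, cimD, creJ, cimJ) /=; ring.
Qed.
Lemma sqnN v : sqn (- v) = sqn v.
Proof. by rewrite -scaleN1r sqnZ cmodN cmod1 expr1n mul1r. Qed.

Lemma cauchy_schwarz v w : cmod (hdot v w) ^+ 2 <= sqn v * sqn w.
Proof.
have [w0|w0] := eqVneq (sqn w) 0.
  by rewrite (sqn_eq0 w0) hdotJ hdot0l cconj0 cmod0 sqn0 mulr0 expr0n.
have {}w0 : 0 < sqn w by rewrite lt_def w0 sqn_ge0.
rewrite -(ler_pM2l w0) -subr_ge0.
(* This vector is [sqn w] times the component of [v] orthogonal to [w]. *)
have := sqn_ge0 (rc (sqn w) *: v + (- hdot v w) *: w).
rewrite sqnD !sqnZ hdotZl hdotZr cmodN cmod_rc (gtr0_norm w0).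
rewrite (_ : cconj (- hdot v w) = - cconj (hdot v w)); last first.
  by apply: c_eq; rewrite !(creJ, cimJ, creN, cimN).
rewrite mulNr mulrN creN mulrCA !creM !cimM creJ cimJ /= cmod_sqr.
by congr (_ <= _); ring.
Qed.

Lemma cmod_hdot_lt1 v w : sqn v < 1 -> sqn w < 1 -> cmod (hdot v w) < 1.
Proof.
move=> v1 w1; rewrite -(@ltr_pXn2r _ 2) ?nnegrE ?cmod_ge0// expr1n.
rewrite (le_lt_trans (cauchy_schwarz v w))//.
have [->|w0] := eqVneq (sqn w) 0; first by rewrite mulr0.
rewrite (lt_trans _ w1)// gtr_pMl// lt_def w0 sqn_ge0//.
Qed.

Lemma sub1_neq0 (c : C) : cmod c < 1 -> 1 - c != 0.
Proof.
move=> c1; rewrite subr_eq0 eq_sym; apply/eqP => c1'.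
by move: c1; rewrite c1' cmod1 ltxx.
Qed.

(** Up to sign and denominator, the factor by which the involution below scales the orthogonal
    complement of [a]. With [s] for this number, [sqn a = 1 - s ^+ 2], so [1 / (1 + s)] stands for
    [(1 - s) / sqn a]. *)
Definition comp_s (a : 'rV[C]_k) : R := Num.sqrt (1 - sqn a).

(* The involutive automorphism of the ball exchanging [0] and [a], with the
   projection onto the line spanned by [a] written without dividing by [a]. *)
Definition ball_moebius (a z : 'rV[C]_k) : 'rV[C]_k :=
  (1 - hdot z a)^-1 *:
    ((1 - hdot z a / rc (1 + comp_s a)) *: a - rc (comp_s a) *: z).

Lemma comp_s_sqr a : sqn a < 1 -> sqn a = 1 - comp_s a ^+ 2.
Proof. by move=> a1; rewrite sqr_sqrtr ?subr_ge0 ?(ltW a1)// opprB addrC subrK. Qed.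

Lemma comp_s_gt0 a : sqn a < 1 -> 0 < comp_s a.
Proof. by move=> a1; rewrite sqrtr_gt0 subr_gt0. Qed.

Lemma ball_moebius0 a : ball_moebius a 0 = a.
Proof. by rewrite /ball_moebius hdot0l subr0 invr1 mul0r subr0 !scale1r scaler0 subr0. Qed.

(** Positivity of the right-hand side is what makes the involution preserve the ball. *)
Lemma ball_moebius_sqn a z : sqn a < 1 -> sqn z < 1 ->
  1 - sqn (ball_moebius a z) = comp_s a ^+ 2 * (1 - sqn z) / cmod (1 - hdot z a) ^+ 2.
Proof.
move=> a1 z1; have c1 := cmod_hdot_lt1 z1 a1.
set c := hdot z a in c1 *; set s := comp_s a.
have s0 : 0 < s := comp_s_gt0 a1.
have c10 : cmod (1 - c) != 0 by rewrite cmod_eq0 sub1_neq0.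
rewrite sqnZ cmodV -/c exprVn -[X in X - _](@mulVf _ (cmod (1 - c) ^+ 2)); last by rewrite sqrf_eq0.
rewrite -mulrBr mulrC; congr (_ / _).
rewrite -(scaleNr (rc s) z) sqnD !sqnZ hdotZl hdotZr (hdotJ z a) -/c cmodN cmod_rc (gtr0_norm s0).
rewrite (comp_s_sqr a1) -/s !cmod_sqr.
rewrite -rcN cconj_rc (_ : c / rc (1 + s) = c * rc (1 + s)^-1); last first.
  by congr (_ * _); rewrite /rc fmorphV.
rewrite !(creM, cimM, creD, cimD, creN, cimN, creJ, cimJ) /=.
by field; rewrite gt_eqF// addr_gt0.
Qed.

Lemma ball_moebius_ball a z : sqn a < 1 -> sqn z < 1 -> sqn (ball_moebius a z) < 1.
Proof.
move=> a1 z1; rewrite -subr_gt0 ball_moebius_sqn// divr_gt0//.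
  by rewrite mulr_gt0 ?subr_gt0// exprn_gt0 ?comp_s_gt0.
by rewrite exprn_gt0// cmod_gt0 sub1_neq0// cmod_hdot_lt1.
Qed.

Lemma ball_moebiusK a z : sqn a < 1 -> sqn z < 1 ->
  ball_moebius a (ball_moebius a z) = z.
Proof.
move=> a1 z1; have c1 := sub1_neq0 (cmod_hdot_lt1 z1 a1).
have s0 := comp_s_gt0 a1; have E := comp_s_sqr a1.
set s := comp_s a in s0 E.
have rs0 : rc s != 0 by rewrite -rc0 (inj_eq (@rc_inj R)) gt_eqF.
have r1s0 : 1 + rc s != 0 by rewrite -rc1 -rcD -rc0 (inj_eq (@rc_inj R)) gt_eqF// addr_gt0.
set c := hdot z a in c1.
have Ew : hdot (ball_moebius a z) a = (1 - rc s ^+ 2 - c) / (1 - c).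
  rewrite /ball_moebius -/c -/s hdotZl hdotDl hdotZl -(scaleNr (rc s) z) hdotZl hdot_sqn -/c E.
  rewrite !(rcD, rcN, rcX, rc1); field.
  by apply/andP; split.
rewrite {1}/ball_moebius Ew -/s.
rewrite (_ : 1 - (1 - rc s ^+ 2 - c) / (1 - c) = rc s ^+ 2 / (1 - c)); last by field.
apply/rowP => i; rewrite /ball_moebius -/c -/s !mxE !(rcD, rc1); field.
by apply/and3P; split.
Qed.

End Hermitian.

(** * Schwarz's lemma in the ball *)

Section HolomorphicBall.
Variables (R : realType) (k : nat).
Local Notation C := (Complex R).
Local Notation V := 'rV[C]_k.
Implicit Types (u v w z : V).

Lemma differentiable_bigsum (W : normedModType C) (I : Type) (s : seq I) (f : I -> W -> C) (x : W) :
  (forall i, differentiable (f i) x) -> differentiable (fun y => \sum_(i <- s) f i y) x.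
Proof.
move=> fd; elim: s => [|i s IH].
  by rewrite (_ : (fun _ => _) = cst 0); [exact: differentiable_cst|apply: funext => y; rewrite big_nil].
rewrite (_ : (fun _ => _) = (fun y => f i y + \sum_(j <- s) f j y)); first exact: differentiableD.
by apply: funext => y; rewrite big_cons.
Qed.

Lemma differentiable_hdot (W : normedModType C) (F : W -> V) v (x : W) :
  differentiable F x -> differentiable (fun y => hdot (F y) v) x.
Proof.
move=> Fx; apply: differentiable_bigsum => i.
apply: differentiableM; last exact: differentiable_cst.
apply: (@differentiable_comp _ _ _ _ F (fun M : V => M ord0 i)) => //.
exact: differentiable_coord.
Qed.

Lemma differentiable_subC (W : normedModType C) (c : C) (f : W -> C) (x : W) :
  differentiable f x -> differentiable (fun y => c - f y) x.
Proof. by move=> fx; apply: (differentiableB (differentiable_cst c x) fx). Qed.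

Lemma differentiable_mulC (W : normedModType C) (f g : W -> C) (x : W) :
  differentiable f x -> differentiable g x -> differentiable (fun y => f y * g y) x.
Proof. exact: differentiableM. Qed.

Lemma differentiable_invC (W : normedModType C) (f : W -> C) (x : W) :
  differentiable f x -> f x != 0 -> differentiable (fun y => (f y)^-1) x.
Proof. exact: differentiableV. Qed.

Lemma holomorphic_ball_moebius a z : sqn a < 1 -> sqn z < 1 -> differentiable (ball_moebius a) z.
Proof.
move=> a1 z1; have c1 := sub1_neq0 (cmod_hdot_lt1 z1 a1).
have hd : differentiable (fun y => hdot y a) z by apply: (@differentiable_hdot _ id).
pose B y := (1 - hdot y a)^-1.
have Bd : differentiable B z := differentiable_invC (differentiable_subC 1 hd) c1.
pose r := (rc (1 + comp_s a))^-1.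
pose A y := B y * (1 - hdot y a * r).
have Ad : differentiable A z.
  exact: (differentiable_mulC Bd (differentiable_subC 1
    (differentiable_mulC hd (differentiable_cst r z)))).
pose E i y := - rc (comp_s a) * (B y * y ord0 i).
have Ed i : differentiable (E i) z.
  exact: (differentiable_mulC (differentiable_cst (- rc (comp_s a)) z)
    (differentiable_mulC Bd (differentiable_coord z ord0 i))).
(* The term in [y] is expanded in the standard basis, so that every summand is a scalar function
   times a fixed vector. *)
rewrite (_ : ball_moebius a =
    (fun y => A y *: a) \+ \sum_(i < k) (fun y => E i y *: delta_mx ord0 i)); last first.
  apply: funext => y; rewrite /= fct_sumE {1}/ball_moebius scalerBr scalerA -/(B y) -/(A y).
  congr (_ + _); rewrite -scalerN -scaleNr.
  rewrite [X in _ *: (_ *: X)](row_sum_delta y) !scaler_sumr; apply: eq_bigr => i _.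
  by rewrite !scalerA /E; congr (_ *: _); ring.
apply: differentiableD; first exact: differentiableZl.
by apply: differentiable_sum => i; exact: differentiableZl.
Qed.

Lemma differentiable_line u (l : C) : differentiable (fun y : C => y *: u) l.
Proof. by apply: (@differentiableZl _ _ _ (@id C)). Qed.

Definition ball_holomorphic l (F : V -> 'rV[C]_l) :=
  forall z, sqn z < 1 -> differentiable F z.

Lemma differentiable_slice l (F : V -> 'rV[C]_l) u (x : C) :
  ball_holomorphic F -> sqn (x *: u) < 1 -> differentiable (fun y : C => F (y *: u)) x.
Proof.
move=> Fh xu; apply: (@differentiable_comp _ _ _ _ (fun y : C => y *: u) F).
  exact: differentiable_line.
exact: Fh.
Qed.

End HolomorphicBall.

Section SchwarzBall.
Variables (R : realType).
Local Notation C := (Complex R).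

(** Reduction to the disc: restrict [F] to the complex line through [z] and pair its values with the
    unit vector [v] along [F z]. At the parameter [rho] the pairing is exactly the Euclidean length
    of [F z]. *)
Theorem ball_schwarz k l (F : 'rV[C]_k -> 'rV[C]_l) z : ball_holomorphic F ->
  (forall w, sqn w < 1 -> sqn (F w) < 1) -> F 0 = 0 -> sqn z < 1 ->
  sqn (F z) <= sqn z.
Proof.
move=> Fh F1 F0 z1.
have [->|z0] := eqVneq (sqn (F z)) 0; first exact: sqn_ge0.
have {}z0 : 0 < sqn (F z) by rewrite lt_def z0 sqn_ge0.
have sz0 : 0 < sqn z.
  rewrite lt_def sqn_ge0 andbT; apply: contraTneq z0 => /sqn_eq0 ->.
  by rewrite F0 sqn0 ltxx.
pose rho := Num.sqrt (sqn z); pose sg := Num.sqrt (sqn (F z)).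
have rho0 : 0 < rho by rewrite sqrtr_gt0.
have sg0 : 0 < sg by rewrite sqrtr_gt0.
have rho2 : rho ^+ 2 = sqn z by rewrite sqr_sqrtr// ltW.
have sg2 : sg ^+ 2 = sqn (F z) by rewrite sqr_sqrtr// ltW.
have rr : rc rho != 0 by rewrite -cmod_gt0 cmod_rc gtr0_norm.
pose u := (rc rho)^-1 *: z; pose v := (rc sg)^-1 *: F z.
have u1 : sqn u = 1.
  by rewrite sqnZ cmodV cmod_rc gtr0_norm// exprVn rho2 mulVf// gt_eqF.
have v1 : sqn v = 1.
  by rewrite sqnZ cmodV cmod_rc gtr0_norm// exprVn sg2 mulVf// gt_eqF.
have lu (x : C) : cmod x < 1 -> sqn (x *: u) < 1.
  by move=> x1; rewrite sqnZ u1 mulr1 exprn_ilt1 ?cmod_ge0.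
pose g (x : C) := hdot (F (x *: u)) v.
have gd (x : C) : cmod x < 1 -> differentiable g x.
  move=> x1; apply: (@differentiable_hdot _ _ _ (fun y : C => F (y *: u))).
  by apply: differentiable_slice => //; exact: lu.
have g1 x : cmod x < 1 -> cmod (g x) <= 1.
  move=> x1; rewrite -(@ler_pXn2r _ 2) ?nnegrE ?cmod_ge0// expr1n.
  by rewrite (le_trans (cauchy_schwarz _ _))// v1 mulr1 ltW// F1// lu.
have g0 : g 0 = 0 by rewrite /g scale0r F0 hdot0l.
have rho1 : cmod (rc rho) < 1.
  by rewrite cmod_rc gtr0_norm// -(@ltr_pXn2r _ 2) ?nnegrE ?(ltW rho0)// rho2 expr1n.
have := schwarz gd g1 g0 rho1.
rewrite /g scalerA divff// scale1r /v hdotZr hdot_sqn.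
rewrite cmodM cmodJ cmodV !cmod_rc !gtr0_norm// -sg2.
rewrite expr2 mulKf ?gt_eqF// => sr.
by rewrite -rho2 -expr2 ler_pXn2r ?nnegrE// ltW.
Qed.

End SchwarzBall.

(** * Cartan's theorem *)

Section Cartan.
Variables (R : realType) (k : nat).
Local Notation C := (Complex R).
Local Notation V := 'rV[C]_k.
Implicit Types (u v w z : V).

Lemma slice_derivative (F : V -> V) u (e : R) : differentiable F 0 -> F 0 = 0 -> 0 < e ->
  exists2 d : R, 0 < d & forall h : C, h != 0 -> cmod h < d ->
    forall i, cmod (F (h *: u) ord0 i / h - ('d F 0 u) ord0 i) <= e.
Proof.
move=> Fd F0 e0; have Fu : derivable F 0 u by exact: diff_derivable.
have qc : h^-1 *: ((F \o shift 0) (h *: u) - F 0) @[h --> (0 : C)^'] --> 'd F 0 u.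
  by rewrite -(deriveE _ Fd); exact: Fu.
have H : \forall h \near (0 : C)^', forall i : 'I_k,
    cmod (F (h *: u) ord0 i / h - ('d F 0 u) ord0 i) <= e.
  apply: filter_forall => i.
  have ci := cvg_comp _ _ qc (@coord_continuous C 1 k ord0 i ('d F 0 u)).
  have /cvgrPdist_le/(_ (rc e)) := ci.
  rewrite -rc0 rc_lt => /(_ e0); apply: filterS => h.
  rewrite normE rc_le cmodBC /= /shift /= addr0 F0 subr0 mxE mulrC.
  by [].
have [d' /= /posC_rc[d d0 ->] {}H] := H.
exists d => // h h0 hd; apply: H => //=.
by rewrite sub0r normrN normE rc_lt.
Qed.

Lemma sqn_close v w (e : R) : 0 <= e -> e <= 1 -> (forall i, cmod (v ord0 i - w ord0 i) <= e) ->
  `|sqn v - sqn w| <= e * \sum_i (2 * cmod (w ord0 i) + 1).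
Proof.
move=> e0 e1 vw; rewrite /sqn -sumrB mulr_sumr (le_trans (ler_norm_sum _ _ _))//.
apply: ler_sum => i _.
set a := cmod (v _ _); set b := cmod (w _ _).
have b0 : 0 <= b := cmod_ge0 _; have a0 : 0 <= a := cmod_ge0 _.
have ab : a <= b + e.
  rewrite /a -(subrK (w ord0 i) (v ord0 i)) (le_trans (cmodD _ _))// addrC lerD2l; exact: vw.
have ba : b <= a + e.
  rewrite /b -(subrK (v ord0 i) (w ord0 i)) (le_trans (cmodD _ _))// addrC lerD2l cmodBC; exact: vw.
rewrite subr_sqr normrM; apply: ler_pM => //; first by rewrite ler_norml; apply/andP; split; lra.
by rewrite ger0_norm ?addr_ge0//; lra.
Qed.

Lemma le_of_arb (x S : R) : 0 <= S -> (forall e, 0 < e -> e <= 1 -> x <= e * S) -> x <= 0.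
Proof.
move=> S0 H; rewrite leNgt; apply/negP => x0.
pose e := Order.min 1 (x / (2 * (S + 1))).
have S1 : 0 < S + 1 by rewrite ltr_wpDl.
have e0 : 0 < e by rewrite lt_min ltr01 divr_gt0// mulr_gt0.
have e1 : e <= 1 by rewrite ge_min lexx.
have := H e e0 e1; apply/negP; rewrite -ltNge.
have : e * S <= x / (2 * (S + 1)) * (S + 1).
  by apply: ler_pM; rewrite ?(ltW e0)// ?lerDl// ge_min lexx orbT.
rewrite (_ : _ * (S + 1) = x / 2); last by field; rewrite gt_eqF.
lra.
Qed.

Lemma cmod_hdot_close v w x (e : R) : 0 <= e -> (forall i, cmod (v ord0 i - w ord0 i) <= e) ->
  cmod (hdot v x - hdot w x) <= e * \sum_i cmod (x ord0 i).
Proof.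
move=> e0 vw; rewrite /hdot -sumrB mulr_sumr.
apply: (@le_trans _ _ (\sum_i cmod (v ord0 i * cconj (x ord0 i) - w ord0 i * cconj (x ord0 i)))).
  elim/big_rec2: _ => [|i a b _ ab]; first by rewrite cmod0.
  by rewrite (le_trans (cmodD _ _))// lerD2l.
apply: ler_sum => i _; rewrite -mulrBl cmodM cmodJ ler_wpM2r ?cmod_ge0//; exact: vw.
Qed.

Lemma near_eq_differentiable (f g : C -> C) (x : C) : (\forall y \near x, f y = g y) ->
  differentiable f x -> differentiable g x.
Proof.
move=> fg /derivable1_diffP fd; apply/derivable1_diffP.
exact: (near_eq_derivable fg fd).
Qed.

(* With [|u| = 1] and [L] the differential of [F] at [0], the function
   [h x = <F (x u), L u> / x] has modulus at most 1 and value 1 at the origin,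
   so it is constant. *)
Theorem cartan_linear (F : V -> V) z : ball_holomorphic F -> F 0 = 0 ->
  (forall w, sqn w < 1 -> sqn (F w) = sqn w) -> sqn z < 1 -> F z = 'd F 0 z.
Proof.
move=> Fh F0 Fn z1.
have Fd : differentiable F 0 by apply: Fh; rewrite sqn0.
have [z0|z0] := eqVneq (sqn z) 0.
  by rewrite (sqn_eq0 z0) F0 linear0.
have sz0 : 0 < sqn z by rewrite lt_def z0 sqn_ge0.
pose rho := Num.sqrt (sqn z).
have rho0 : 0 < rho by rewrite sqrtr_gt0.
have rho2 : rho ^+ 2 = sqn z by rewrite sqr_sqrtr// ltW.
have rr : rc rho != 0 by rewrite -cmod_gt0 cmod_rc gtr0_norm.
pose u := (rc rho)^-1 *: z.
have zu : z = rc rho *: u by rewrite scalerA divff// scale1r.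
have u1 : sqn u = 1.
  by rewrite sqnZ cmodV cmod_rc gtr0_norm// exprVn rho2 mulVf// gt_eqF.
have lu (x : C) : cmod x < 1 -> sqn (x *: u) < 1.
  by move=> x1; rewrite sqnZ u1 mulr1 exprn_ilt1 ?cmod_ge0.
have Fl (x : C) : cmod x < 1 -> sqn (F (x *: u)) = cmod x ^+ 2.
  by move=> x1; rewrite Fn ?lu// sqnZ u1 mulr1.
set v : V := 'd F 0 u.
(* [v] is the limit of the unit vectors [F (t u) / t] as [t] tends to [0]. *)
have v1 : sqn v = 1.
  apply/eqP; rewrite eq_sym -subr_eq0 -normr_eq0 eq_le normr_ge0 andbT.
  apply: (@le_of_arb _ (\sum_i (2 * cmod (v ord0 i) + 1))).
    by apply: sumr_ge0 => i _; rewrite addr_ge0// mulr_ge0 ?cmod_ge0.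
  move=> e e0 e1; have [d d0 H] := slice_derivative u Fd F0 e0.
  pose t := Order.min (d / 2) (1 / 2).
  have t0 : 0 < t by rewrite lt_min !divr_gt0.
  have td : t < d by rewrite gt_min; apply/orP; left; lra.
  have t1 : t < 1 by rewrite gt_min; apply/orP; right; lra.
  have ct : cmod (rc t) = t by rewrite cmod_rc gtr0_norm.
  have ct0 : rc t != 0 by rewrite -cmod_gt0 ct.
  have {H} := H (rc t) ct0; rewrite ct => /(_ td) H.
  pose w := (rc t)^-1 *: F (rc t *: u).
  have w1 : sqn w = 1.
    by rewrite sqnZ Fl ?ct// cmodV ct exprVn mulVf// sqrf_eq0 gt_eqF.
  rewrite -[X in X - _]w1; apply: sqn_close => //; first exact: ltW.
  by move=> i; rewrite mxE mulrC; exact: H.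
(* The value 1 at [0] is the limit of the quotient, namely [hdot v v], so [h] is continuous
   there. *)
pose h (x : C) : C := if x == 0 then 1 else hdot (F (x *: u)) v / x.
have h0 : h 0 = 1 by rewrite /h eqxx.
have hE x : x != 0 -> h x = hdot (F (x *: u)) v / x by rewrite /h => /negbTE ->.
have hM x : x != 0 -> cmod x < 1 -> cmod (h x) <= 1.
  move=> x0 x1; rewrite hE// cmodM cmodV ler_pdivrMr ?cmod_gt0// mul1r.
  rewrite -(@ler_pXn2r _ 2) ?nnegrE ?cmod_ge0//.
  by rewrite (le_trans (cauchy_schwarz _ _))// v1 mulr1 Fl.
have hc : {for 0, continuous h}.
  apply/continuous_cmodP => e e0.
  pose S := \sum_i cmod (v ord0 i) + 1.
  have S0 : 0 < S by rewrite ltr_wpDl// sumr_ge0// => i _; exact: cmod_ge0.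
  have [d d0 H] := slice_derivative u Fd F0 (divr_gt0 e0 S0).
  exists d => // x; rewrite subr0 => xd.
  have [->|x0] := eqVneq x 0; first by rewrite subrr cmod0 ltW.
  rewrite h0 hE// mulrC -hdotZl -[1 in X in cmod (_ - X)]rc1 -v1 -hdot_sqn.
  rewrite (le_trans (cmod_hdot_close (e := e / S) _ _ _))//.
  - by rewrite divr_ge0 ?ltW.
  - by move=> i; rewrite mxE mulrC; exact: H.
  rewrite -ler_pdivlMl ?divr_gt0// invf_div divfK ?gt_eqF// /S.
  by rewrite lerDl.
have hd x : 0 < cmod x < 1 -> differentiable h x.
  move=> /andP[x0 x1]; rewrite cmod_gt0 in x0.
  apply: (@near_eq_differentiable (fun y => hdot (F (y *: u)) v / y)).
    have : \forall y \near x, y != 0.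
      exists `|x|; first by rewrite /= normr_gt0.
      by move=> y /=; apply: contraTneq => ->; rewrite subr0 ltxx.
    by apply: filterS => y y0; rewrite hE.
  apply: differentiableM; last by apply: differentiableV.
  by apply: (@differentiable_hdot _ _ _ (fun y : C => F (y *: u))); apply: differentiable_slice => //; exact: lu.
have rho1 : 0 < cmod (rc rho) < 1.
  rewrite cmod_rc gtr0_norm// rho0 -(@ltr_pXn2r _ 2) ?nnegrE ?(ltW rho0)//.
  by rewrite rho2 expr1n.
have : h (rc rho) = 1.
  apply: strong_max => // w wr.
  apply: hM; first by rewrite -cmod_gt0 wr; case/andP: rho1.
  by rewrite wr; case/andP: rho1.
rewrite hE// -zu => /(congr1 (fun x => x * rc rho)); rewrite divfK// mul1r => hz.
rewrite [in RHS]zu linearZ -/v.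
(* Equality case of Cauchy-Schwarz: [F z] has length [rho], [v] has length 1 and their product is
   [rho], so the squared distance from [F z] to [rho v] is
   [rho ^+ 2 - 2 rho ^+ 2 + rho ^+ 2 = 0]. *)
apply/eqP; rewrite -subr_eq0; apply/eqP/sqn_eq0.
rewrite sqnD sqnN sqnZ v1 mulr1 Fn// -scaleN1r hdotZr hdotZr hz.
rewrite cmod_rc gtr0_norm// -rho2 cconj_rc.
rewrite (_ : cconj (-1) = -1); last by apply: c_eq; rewrite ?(creJ, cimJ) ?creN ?cimN/= ?oppr0.
by rewrite mulN1r creN -rcM /=; ring.
Qed.

End Cartan.

(** * The zero set of a component of a ball automorphism *)

Section Automorphism.
Variables (R : realType) (k : nat).
Local Notation C := (Complex R).
Local Notation V := 'rV[C]_k.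
Implicit Types (u v w z : V).

Lemma hdotDr u v w : hdot u (v + w) = hdot u v + hdot u w.
Proof. by rewrite hdotJ hdotDl cconjD -!hdotJ. Qed.

Lemma automorphism_affine (psi : V -> V) (j : 'I_k) : ball_automorphism psi ->
  exists (al : C) b, ~ (al = 0 /\ b = 0) /\
    forall w, sqn w < 1 -> psi w ord0 j = 0 -> al + hdot w b = 0.
Proof.
move=> [chi [psiB chiB psih chih inv]].
have ball0 : sqn (0 : V) < 1 by rewrite sqn0.
have {}psiB w : sqn w < 1 -> sqn (psi w) < 1.
  by move=> w1; have := psiB w; rewrite !unit_ballE; apply.
have {}chiB w : sqn w < 1 -> sqn (chi w) < 1.
  by move=> w1; have := chiB w; rewrite !unit_ballE; apply.
have {}psih : ball_holomorphic psi by move=> w w1; apply: psih; rewrite unit_ballE.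
have {}chih : ball_holomorphic chi by move=> w w1; apply: chih; rewrite unit_ballE.
have chiK w : sqn w < 1 -> chi (psi w) = w.
  by move=> w1; have [] := inv w; rewrite ?unit_ballE.
have psiK w : sqn w < 1 -> psi (chi w) = w.
  by move=> w1; have [] := inv w; rewrite ?unit_ballE.
set a := chi 0; have a1 : sqn a < 1 by exact: chiB.
pose F := psi \o ball_moebius a; pose G := ball_moebius a \o chi.
have mB w : sqn w < 1 -> sqn (ball_moebius a w) < 1 by exact: ball_moebius_ball.
have Fh : ball_holomorphic F.
  move=> w w1; apply: differentiable_comp; first exact: holomorphic_ball_moebius.
  by apply: psih; exact: mB.
have Gh : ball_holomorphic G.
  move=> w w1; apply: differentiable_comp; first exact: chih.
  by apply: holomorphic_ball_moebius => //; exact: chiB.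
have F0 : F 0 = 0 by rewrite /F /= ball_moebius0 /a psiK.
have G0 : G 0 = 0 by rewrite /G /= -/a -{2}(ball_moebius0 a) ball_moebiusK.
have FB w : sqn w < 1 -> sqn (F w) < 1 by move=> w1; apply/psiB/mB.
have GB w : sqn w < 1 -> sqn (G w) < 1 by move=> w1; apply/mB/chiB.
have GF w : sqn w < 1 -> G (F w) = w.
  by move=> w1; rewrite /G /F /= chiK ?mB// ball_moebiusK.
(* Schwarz for [F] and for its inverse [G] gives the two inequalities. *)
have Fn w : sqn w < 1 -> sqn (F w) = sqn w.
  move=> w1; apply/eqP; rewrite eq_le ball_schwarz//=.
  by rewrite -{1}(GF w w1) ball_schwarz// FB.
have psiE w : sqn w < 1 -> psi w = 'd F 0 (ball_moebius a w).
  by move=> w1; rewrite -(cartan_linear Fh F0 Fn) ?mB// /F /= ball_moebiusK.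
pose l (v : V) : C := ('d F 0 v) ord0 j.
have lD u v : l (u + v) = l u + l v by rewrite /l linearD mxE.
have lZ c v : l (c *: v) = c * l v by rewrite /l linearZ mxE.
have lN v : l (- v) = - l v by rewrite /l linearN mxE.
(* The vector representing the linear form [l] through [hdot]. *)
pose lv : V := \row_i cconj (l (delta_mx ord0 i)).
have lE v : l v = hdot v lv.
  rewrite {1}(row_sum_delta v) /l linear_sum summxE; apply: eq_bigr => i _.
  by rewrite mxE cconjK -lZ.
pose r := (rc (1 + comp_s a))^-1.
(* The numerator is [(1 - hdot w a * r) * l a - rc (comp_s a) * l w]; the conjugate appears because
   [hdot] is antilinear in its second argument. *)
exists (l a), (- cconj (r * l a) *: a + - rc (comp_s a) *: lv); split; last first.
  move=> w w1; rewrite psiE// -/(l _) /ball_moebius lZ.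
  have c1 := sub1_neq0 (cmod_hdot_lt1 w1 a1).
  move/eqP; rewrite mulf_eq0 invr_eq0 (negbTE c1) /= => /eqP.
  rewrite lD lN !lZ (lE w) => E.
  rewrite hdotDr !hdotZr -[RHS]E /r.
  have cN (x : C) : cconj (- x) = - cconj x.
    by apply: c_eq; rewrite ?(creJ, cimJ) ?(creN, cimN) ?(creJ, cimJ).
  rewrite !cN cconjK cconj_rc; ring.
move=> [la0]; rewrite la0 mulr0 cconj0 oppr0 scale0r add0r => /eqP.
rewrite scaler_eq0 oppr_eq0 -rc0 (inj_eq (@rc_inj R)) gt_eqF ?comp_s_gt0//= => /eqP lv0.
have l0 v : l v = 0 by rewrite lE lv0 hdotJ hdot0l cconj0.
(* A point of the ball with nonzero coordinate [j]; it is the value of [psi] at [chi e]. *)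
pose e : V := (1 / 2) *: delta_mx ord0 j.
have e1 : sqn e < 1.
  rewrite sqnZ (_ : sqn _ = 1); last first.
    rewrite /sqn (bigD1 j)//= mxE !eqxx cmod1 expr1n big1 ?addr0// => i ij.
    by rewrite mxE (negbTE ij) andbF cmod0 expr0n.
  rewrite mulr1 (_ : 1 / 2 = rc (1 / 2)) ?cmod_rc; last by rewrite rcM /rc fmorphV /= rmorph_nat.
  by rewrite ger0_norm ?divr_ge0// expr2; lra.
have : psi (chi e) ord0 j = 0 by rewrite psiE ?chiB// -/(l _) l0.
rewrite psiK// !mxE !eqxx mulr1 => /eqP.
by rewrite mulf_eq0 oner_eq0 invr_eq0 pnatr_eq0.
Qed.

End Automorphism.

(** * Monomial maps *)

Section Compactness.
Variable R : realType.
Local Notation C := (Complex R).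

Definition pair_C (p : R * R) : C := p.1 +i* p.2.

Lemma continuous_pair_C : continuous pair_C.
Proof.
move=> p; apply/(@cvgrPdist_le _ _ _ (nbhs p)) => e' /posC_rc[e e0 ->].
have e20 : 0 < e / 2 by rewrite divr_gt0.
have h : \forall q \near p, `|p.1 - q.1| < e / 2 /\ `|p.2 - q.2| < e / 2.
  exists (ball p.1 (e / 2), ball p.2 (e / 2)); first by split; exact: nbhsx_ballx.
  by move=> q [].
apply: filterS h => q [q1 q2].
rewrite normE rc_le (le_trans (cmod_le_re_im _))// creD creN cimD cimN /=; lra.
Qed.

Lemma compact_square : compact [set c : C | `|cre c| <= 1 /\ `|cim c| <= 1].
Proof.
have -> : [set c : C | `|cre c| <= 1 /\ `|cim c| <= 1] =
    pair_C @` (`[-1, 1] `*` `[-1, 1]).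
  apply/seteqP; split => [c [c1 c2]|_ [[x y] [/= x1 y1] <-]].
    exists (cre c, cim c); last by case: c {c1 c2}.
    by split; rewrite /= in_itv/= -ler_norml.
  by move: x1 y1; rewrite !in_itv/= -!ler_norml.
apply: continuous_compact; first by apply: continuous_subspaceT; exact: continuous_pair_C.
by apply: compact_setX; exact: segment_compact.
Qed.

Lemma compact_box n : compact
  [set v : 'rV[C]_n | forall i, `|cre (v ord0 i)| <= 1 /\ `|cim (v ord0 i)| <= 1].
Proof. exact: (@rV_compact C n (fun=> _) (fun=> compact_square)). Qed.

(** As the equivalence holds on all of the source space, the preimage of [K] within the ball is the
    full preimage, which is closed; lying in the ball, it is contained in a compact box. *)
Lemma proper_of_continuous n N (f : 'rV[C]_n -> 'rV[C]_N) : continuous f ->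
  (forall z, sqn (f z) < 1 <-> sqn z < 1) -> proper_ball_map f.
Proof.
move=> fc fB; split=> [z|K KB Kc].
  by rewrite !unit_ballE => /fB.
have -> : @unit_ball R n `&` f @^-1` K = f @^-1` K.
  by apply/setIidPr => z /= /KB; rewrite !unit_ballE => /fB.
apply: (subclosed_compact _ (compact_box (n := n))).
  apply: preimage_closed; first by move=> z _; exact: fc.
  by apply: compact_closed Kc; exact: norm_hausdorff.
move=> z /= /KB; rewrite unit_ballE => /fB z1 i.
have zi : cmod (z ord0 i) <= 1.
  rewrite -(@ler_pXn2r _ 2) ?nnegrE ?cmod_ge0// expr1n (le_trans _ (ltW z1))//.
  by rewrite /sqn (bigD1 i)//= lerDl sumr_ge0// => l _; rewrite sqr_ge0.
by split; [rewrite (le_trans (cre_le _))|rewrite (le_trans (cim_le _))].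
Qed.

End Compactness.

Lemma sum_prod (W : nmodType) (I J : finType) (G : I * J -> W) :
  \sum_t G t = \sum_i \sum_l G (i, l).
Proof. by rewrite pair_bigA; apply: eq_bigr => -[]. Qed.

Section MonomialMap.
Variables (R : realType) (m k j : nat).
Hypothesis jk : (j <= k)%N.
Variables p q : R.
Hypotheses (p0 : 0 < p) (q0 : 0 < q) (pq : p ^+ 2 = 1 - q ^+ 2).
Local Notation C := (Complex R).
Local Notation n := m.+1.
Local Notation idx := (('I_k.+1 * 'I_m) + 'I_j.+1)%type.

(** At each of the first [j] occasions a pure power splits into [p] times itself, which is kept, and
    [q] times itself, which is tensored. An index [e < j] denotes the part kept at occasion [e]; the
    index [j] is the final pure power. *)
Definition coef_top (e : nat) : R := if (e < j)%N then p * q ^+ e else q ^+ j.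
Definition expo_top (e : nat) : nat := if (e < j)%N then e.+1 else k.+1.

(* Tensoring repeatedly on the pure powers of [z_0]: the first [j] times only a
   part of the component is tensored, the remaining times all of it. *)
Definition monomial (t : idx) (z : 'rV[C]_n) : C :=
  match t with
  | inl (d, i) => rc (q ^+ minn d j) * z ord0 ord0 ^+ d * z ord0 (lift ord0 i)
  | inr e => rc (coef_top e) * z ord0 ord0 ^+ expo_top e
  end.

(** The quotient of [1 - |f|^2] by [1 - |z|^2] for the monomial map, as a polynomial in
    [X = |z_0|^2]. *)
Definition weight (X : R) : R := \sum_(d < k.+1) q ^+ 2 ^+ minn d j * X ^+ d.

(** Multiplication by [1 - X] leaves differences of consecutive coefficients; these are
    [Q ^+ e * (1 - Q)] for [e < j] and zero afterwards. *)
Lemma weight_telescope (Q X : R) t :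
  (1 - X) * (\sum_(d < t.+1) Q ^+ minn d j * X ^+ d) =
  1 - (1 - Q) * (\sum_(e < minn t j) Q ^+ e * X ^+ e.+1) - Q ^+ minn t j * X ^+ t.+1.
Proof.
elim: t => [|t IH].
  by rewrite big_ord1 /= !min0n big_ord0 !expr0; ring.
rewrite big_ord_recr mulrDr IH /=.
have [tj|] := boolP (t < j)%N.
  rewrite (minn_idPl tj) (minn_idPl (ltnW tj)) big_ord_recr /= !exprS; ring.
by rewrite -leqNgt => tj; rewrite (minn_idPr tj) (minn_idPr (leqW tj)) !exprS; ring.
Qed.

(** With [S] the contribution of the coordinates other than [z_0], the mixed monomials add up to
    [S * weight X], and by telescoping the pure powers add up to [1 - (1 - X) * weight X]. *)
Lemma sum_monomial (z : 'rV[C]_n) :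
  \sum_t cmod (monomial t z) ^+ 2 = 1 - (1 - sqn z) * weight (cmod (z ord0 ord0) ^+ 2).
Proof.
set X := cmod _ ^+ 2.
have Y : sqn z = X + \sum_(i < m) cmod (z ord0 (lift ord0 i)) ^+ 2 by rewrite /sqn big_ord_recl.
rewrite Y; set S := \sum_(i < m) _.
rewrite big_sumType /=.
have -> : \sum_(t : 'I_k.+1 * 'I_m) cmod (monomial (inl t) z) ^+ 2 = S * weight X.
  rewrite sum_prod /=.
  rewrite /weight mulr_sumr; apply: eq_bigr => d _; rewrite mulr_suml; apply: eq_bigr => i _.
  rewrite !cmodM cmodX cmod_rc ger0_norm ?exprn_ge0 ?(ltW q0)//.
  by rewrite 2![in LHS]exprMn [in LHS](exprAC q) [in LHS](exprAC (cmod _)) -/X mulrC.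
have := weight_telescope (q ^+ 2) X k; rewrite -/(weight X) (minn_idPr jk) => E.
have -> : \sum_(e < j.+1) cmod (monomial (inr e) z) ^+ 2 =
    (1 - q ^+ 2) * (\sum_(e < j) (q ^+ 2) ^+ e * X ^+ e.+1) + (q ^+ 2) ^+ j * X ^+ k.+1.
  rewrite big_ord_recr /= /coef_top /expo_top ltnn; congr (_ + _).
    rewrite mulr_sumr; apply: eq_bigr => e _; rewrite ltn_ord.
    rewrite cmodM cmodX cmod_rc ger0_norm ?mulr_ge0 ?exprn_ge0 ?(ltW q0) ?(ltW p0)//.
    rewrite 2![in LHS]exprMn [in LHS](exprAC q) [in LHS](exprAC (cmod _)) -/X [in RHS]mulrA; congr (_ * _ * _).
    exact: pq.
  rewrite cmodM cmodX cmod_rc ger0_norm ?exprn_ge0 ?(ltW q0)//.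
  by rewrite [in LHS]exprMn [in LHS](exprAC q) [in LHS](exprAC (cmod _)) -/X.
have : forall a b c : R, (1 - X) * c = 1 - a - b -> S * c + (a + b) = 1 - (1 - (X + S)) * c.
  by move=> a b c; lra.
by apply; exact: E.
Qed.

Lemma weight_gt0 (X : R) : 0 <= X -> 0 < weight X.
Proof.
move=> X0; rewrite /weight big_ord_recl min0n !expr0 mulr1 ltr_wpDr//.
apply: sumr_ge0 => i _; apply: mulr_ge0; last exact: exprn_ge0.
by rewrite exprn_ge0// sqr_ge0.
Qed.

Lemma differentiable_monomial t (z : 'rV[C]_n) : differentiable (monomial t) z.
Proof.
have pw e : differentiable (fun y : 'rV[C]_n => y ord0 ord0 ^+ e) z.
  elim: e => [|e IH]; first exact: differentiable_cst.
  rewrite (_ : (fun _ => _) = (fun y : 'rV[C]_n => y ord0 ord0 * y ord0 ord0 ^+ e)).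
    exact: (differentiable_mulC (differentiable_coord z ord0 ord0) IH).
  by apply: funext => w; rewrite exprS.
case: t => [[d i]|e].
  exact: (differentiable_mulC (differentiable_mulC (differentiable_cst _ z) (pw _))
    (differentiable_coord z ord0 (lift ord0 i))).
exact: (differentiable_mulC (differentiable_cst _ z) (pw _)).
Qed.

Definition monomial_mpoly (t : idx) : mpoly.mpoly n C :=
  match t with
  | inl (d, i) => mpoly.mpolyC n (rc (q ^+ minn d j)) *
      mpoly.mpolyX C (mpoly.mnm1 ord0) ^+ d * mpoly.mpolyX C (mpoly.mnm1 (lift ord0 i))
  | inr e => mpoly.mpolyC n (rc (coef_top e)) * mpoly.mpolyX C (mpoly.mnm1 ord0) ^+ expo_top e
  end.

Lemma monomial_mpolyE t (z : 'rV[C]_n) :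
  monomial t z = mpoly.meval (fun i => z ord0 i) (monomial_mpoly t).
Proof.
case: t => [[d i]|e] /=.
  by rewrite !mpoly.mevalM rmorphXn /= mpoly.mevalC !mpoly.mevalXU.
by rewrite mpoly.mevalM rmorphXn /= mpoly.mevalC mpoly.mevalXU.
Qed.

Lemma poly_eq0_near0 (P : {poly C}) (r : R) : 0 < r ->
  (forall x : C, cmod x < r -> P.[x] = 0) -> P = 0.
Proof.
(* As many distinct zeros as the size of [P]; dividing by [i.+2] keeps even the first strictly
   inside the disc. *)
move=> r0 H; pose s := [seq rc (r / (i.+2)%:R) | i <- iota 0 (size P)].
apply: (@roots_geq_poly_eq0 _ _ s).
- apply/allP => _ /mapP[i _ ->]; apply/eqP/H.
  rewrite cmod_rc ger0_norm ?divr_ge0 ?(ltW r0)// ltr_pdivrMr//.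
  by rewrite ltr_pMr// ltr1n.
- rewrite map_inj_uniq ?iota_uniq// => a b /(@rc_inj R)/(mulfI _).
  rewrite gt_eqF// => /(_ isT)/invr_inj/eqP; rewrite eqr_nat => /eqP[].
  by [].
- by rewrite size_map size_iota.
Qed.

(** The relation is affine in the coordinates other than [z_0], with the polynomials [P0] and [P1 i]
    in [z_0] as coefficients. They vanish near [0], hence identically, and each [be t] can be read
    off a single coefficient. *)
Lemma monomial_independent (al : C) (be : idx -> C) :
  (forall z, sqn z < 1 -> al + \sum_t monomial t z * be t = 0) ->
  al = 0 /\ forall t, be t = 0.
Proof.
move=> H.
pose P0 : {poly C} := al%:P + \sum_(e < j.+1) (rc (coef_top e) * be (inr e)) *: 'X^(expo_top e).
pose P1 i : {poly C} := \sum_(d < k.+1) (rc (q ^+ minn d j) * be (inl (d, i))) *: 'X^d.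
pose pt (x : C) (y : 'I_m -> C) : 'rV[C]_n :=
  \row_l if unlift ord0 l is Some i then y i else x.
have pt0 x y : pt x y ord0 ord0 = x by rewrite mxE unlift_none.
have ptl x y i : pt x y ord0 (lift ord0 i) = y i by rewrite mxE liftK.
have sqpt x y : sqn (pt x y) = cmod x ^+ 2 + \sum_i cmod (y i) ^+ 2.
  by rewrite /sqn big_ord_recl pt0; congr (_ + _); apply: eq_bigr => i _; rewrite ptl.
have E x y : al + \sum_t monomial t (pt x y) * be t = P0.[x] + \sum_i y i * (P1 i).[x].
  rewrite big_sumType /= addrCA addrC; congr (_ + _).
    rewrite hornerD hornerC horner_sum; congr (_ + _); apply: eq_bigr => e _.
    by rewrite hornerZ hornerXn pt0; ring.
  rewrite sum_prod /=.
  rewrite exchange_big; apply: eq_bigr => i _.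
  rewrite horner_sum mulr_sumr; apply: eq_bigr => d _.
  by rewrite hornerZ hornerXn pt0 ptl; ring.
have P00 : P0 = 0.
  apply: (@poly_eq0_near0 _ 1) => // x x1.
  have := H (pt x (fun=> 0)); rewrite E sqpt !big1 ?addr0; last 2 first.
  - by move=> i _; rewrite mul0r.
  - by move=> i _; rewrite cmod0 expr0n.
  by apply; rewrite exprn_ilt1 ?cmod_ge0.
have half : cmod (rc (1 / 2) : C) = 1 / 2 by rewrite cmod_rc ger0_norm ?divr_ge0.
have P10 i : P1 i = 0.
  apply: (@poly_eq0_near0 _ (1 / 2)); first by rewrite divr_gt0.
  (* Only the coordinate [i] is switched on, which isolates [P1 i]; the halves keep the point in the
     ball. *)
  move=> x x1; pose y l : C := if l == i then rc (1 / 2) else 0.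
  have yi : y i = rc (1 / 2) by rewrite /y eqxx.
  have yl l : l != i -> y l = 0 by rewrite /y => /negbTE ->.
  have S1 : \sum_l cmod (y l) ^+ 2 = (1 / 2) ^+ 2.
    by rewrite (bigD1 i)//= yi half big1 ?addr0// => l /yl ->; rewrite cmod0 expr0n.
  have S2 : \sum_l y l * (P1 l).[x] = rc (1 / 2) * (P1 i).[x].
    by rewrite (bigD1 i)//= yi big1 ?addr0// => l /yl ->; rewrite mul0r.
  have x2 : cmod x ^+ 2 + (1 / 2) ^+ 2 < 1.
    have : cmod x ^+ 2 < (1 / 2) ^+ 2 by rewrite ltr_pXn2r ?nnegrE ?cmod_ge0 ?divr_ge0.
    lra.
  have := H (pt x y); rewrite E sqpt P00 horner0 add0r S1 S2.
  move=> /(_ x2)/eqP; rewrite mulf_eq0 => /orP[|/eqP//].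
  by rewrite -cmod_eq0 half gt_eqF ?divr_gt0.
have rX e : (0 : R) < q ^+ e by rewrite exprn_gt0// q0.
have rc_neq0 (x : R) : 0 < x -> rc x != 0 by move=> x0; rewrite -cmod_gt0 cmod_rc normr_gt0 gt_eqF.
(* The kept exponents run from 1 to [j], and the final one is [k.+1], larger because [j <= k]. *)
have expo_inj : forall a b : 'I_j.+1, expo_top a = expo_top b -> a = b.
  move=> a b; rewrite /expo_top; case: ltnP => aj; case: ltnP => bj.
  - by move=> [] /val_inj.
  - by move=> [] ak; move: jk; rewrite -ak leqNgt aj.
  - by move=> [] bk; move: jk; rewrite bk leqNgt bj.
  - move=> _; have top (l : 'I_j.+1) : (j <= l)%N -> l = j :> nat.
      by move=> jl; apply/eqP; rewrite eqn_leq jl -ltnS ltn_ord.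
    exact: ord_inj (etrans (top a aj) (esym (top b bj))).
have al0 : al = 0.
  have := congr1 (fun P : {poly C} => P`_0) P00.
  rewrite coef0 coefD coefC eqxx coef_sum big1 ?addr0// => e _.
  rewrite coefZ coefXn (_ : (0 == expo_top e)%N = false) ?mulr0//.
  by rewrite /expo_top; case: ifP.
split=> // -[[d i]|e].
  have := congr1 (fun P : {poly C} => P`_d) (P10 i).
  rewrite coef0 coef_sum (bigD1 d)//= big1 ?addr0; last first.
    by move=> l ld; rewrite coefZ coefXn (inj_eq val_inj) eq_sym (negbTE ld) mulr0.
  rewrite coefZ coefXn eqxx mulr1 => /eqP; rewrite mulf_eq0 => /orP[|/eqP//].
  by rewrite (negbTE (rc_neq0 _ (rX _))).
have := congr1 (fun P : {poly C} => P`_(expo_top e)) P00.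
rewrite /P0 al0 add0r coef0 coef_sum (bigD1 e)//= big1 ?addr0; last first.
  move=> l le; rewrite coefZ coefXn; case: eqP => [/expo_inj el|_]; last by rewrite mulr0.
  by rewrite el eqxx in le.
rewrite coefZ coefXn eqxx mulr1 => /eqP; rewrite mulf_eq0 => /orP[|/eqP//].
rewrite (negbTE (rc_neq0 _ _))// /coef_top; case: ifP => _ //.
by rewrite mulr_gt0.
Qed.

End MonomialMap.

(** * Dimension count and assembly of the map *)

(** For positive [m], Euclidean division of [N - 1] by [m]: the quotient [k.+1] is at least [m]
    because [m ^ 2 <= N - 1], while the remainder [j] is below [m]. *)
Lemma dimension_decomposition (m N : nat) : (m ^ 2 < N)%N ->
  exists k j, (j <= k)%N /\ (k.+1 * m + j.+1)%N = N.
Proof.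
case: N => // N mN; case: m mN => [|m] mN.
  by exists N, N; rewrite muln0.
have mq : (m < N %/ m.+1)%N by rewrite leq_divRL// mulnn.
exists (N %/ m.+1).-1, (N %% m.+1)%N; split.
  have := ltn_pmod N (ltn0Sn m); lia.
by rewrite prednK ?(leq_trans _ mq)// addnS -divn_eq.
Qed.

(** Indeed [T m.+1 = m ^ 2 + 1]. *)
Lemma T_lt_sqr (m N : nat) : T m.+1 <= N%:Z -> (m ^ 2 < N)%N.
Proof. by rewrite /T; nia. Qed.

Section Assembly.
Variables (R : realType) (m k j : nat).
Hypothesis jk : (j <= k)%N.
Local Notation C := (Complex R).
Local Notation idx := (('I_k.+1 * 'I_m) + 'I_j.+1)%type.

Definition monomial_map (p q : R) (z : 'rV[C]_m.+1) : 'rV[C]_#|{: idx}| :=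
  \row_i monomial p q (enum_val i : idx) z.

Variables p q : R.
Hypotheses (p0 : 0 < p) (q0 : 0 < q) (pq : p ^+ 2 = 1 - q ^+ 2).
Local Notation f := (monomial_map p q).

Lemma sum_enum_val (W : nmodType) (F : idx -> W) :
  \sum_t F t = \sum_(i < #|{: idx}|) F (enum_val i).
Proof. exact: (reindex enum_val (onW_bij _ (enum_val_bij idx))). Qed.

Lemma monomial_map_ball z : sqn (f z) < 1 <-> sqn z < 1.
Proof.
have -> : sqn (f z) = 1 - (1 - sqn z) * weight k j q (cmod (z ord0 ord0) ^+ 2).
  rewrite -(sum_monomial jk p0 q0 pq) sum_enum_val.
  by apply: eq_bigr => i _; rewrite mxE.
by rewrite gtrBl pmulr_lgt0 ?weight_gt0 ?sqr_ge0// subr_gt0.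
Qed.

Lemma continuous_monomial_map : continuous f.
Proof.
move=> z; apply: differentiable_continuous.
rewrite (_ : (f : _ -> _) = \sum_i (fun y => monomial p q (enum_val i : idx) y *: delta_mx ord0 i)).
  by apply: differentiable_sum => i; apply: differentiableZl; exact: differentiable_monomial.
apply: funext => y; rewrite fct_sumE [LHS]row_sum_delta; apply: eq_bigr => i _.
by rewrite mxE.
Qed.

(** A vanishing component of an equivalent map forces, through [automorphism_affine], a nontrivial
    affine relation on the image of [f], against [monomial_independent]. *)
Lemma monomial_map_minimal : minimal_imbedding_dimension f.
Proof.
move=> g [phi [psi [[chi [_ chiB _ _ inv]] psiA gE]]] [i gi].
(* Evaluation at [chi w] undoes [phi], so the equation holds along the whole image of the ball under
   [f]. *)
have H w : sqn w < 1 -> psi (f w) ord0 i = 0.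
  rewrite -unit_ballE => w1; have [_ <-] := inv w w1.
  by rewrite -gE ?gi//; exact: chiB.
have [al [b [nz rel]]] := automorphism_affine i psiA.
pose be (t : idx) := cconj (b ord0 (enum_rank t)).
have [|al0 be0] := @monomial_independent R m k j jk p q p0 q0 al be.
  move=> z z1; rewrite -[RHS](rel (f z)) ?monomial_map_ball ?H//; congr (_ + _).
    rewrite sum_enum_val; apply: eq_bigr => l _.
    by rewrite mxE /be enum_valK.
apply: nz; split => //; apply/rowP => l; rewrite mxE.
have := be0 (enum_val l); rewrite /be enum_valK => /(congr1 (@cconj R)).
by rewrite cconjK cconj0.
Qed.

Lemma monomial_map_spec :
  [/\ polynomial_map f, proper_ball_map f & minimal_imbedding_dimension f].
Proof.
split; last exact: monomial_map_minimal.
  exists (fun i => monomial_mpoly p q (enum_val i : idx)) => z i.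
  by rewrite mxE monomial_mpolyE.
exact: proper_of_continuous continuous_monomial_map monomial_map_ball.
Qed.

End Assembly.

Theorem theorem3 (R : realType) (n : nat) (hn : (1 <= n)%N) (N : nat)
    (hN : T n <= N%:Z) :
  exists f : 'rV[Complex R]_n -> 'rV[Complex R]_N,
    [/\ polynomial_map f, proper_ball_map f & minimal_imbedding_dimension f].
Proof.
case: n hn hN => // m _ /T_lt_sqr /dimension_decomposition[k [j [jk <-]]].
have cardE : #|{: ('I_k.+1 * 'I_m) + 'I_j.+1}| = (k.+1 * m + j.+1)%N.
  by rewrite card_sum card_prod !card_ord.
(* The amplitudes come from the triple 3, 4, 5, so that [p ^+ 2 + q ^+ 2 = 1] with both positive. *)
rewrite -cardE; exists (@monomial_map R m k j (4 / 5) (3 / 5)).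
by apply: monomial_map_spec => //; field.
Qed.
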